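(* Let $0<b<h<R$ and let $\omega$, $\sigma$, and $\kappa$ be three weight functions satisfying $$\lim_{t\to\infty}\bigl(\sigma(t)-\omega(t)\bigr)=\infty,\qquad \lim_{t\to\infty}\bigl(\kappa(t)-\sigma(t)\bigr)=\infty,$$ and $$\int_0^\infty e^{\omega(t)-\sigma(t)}\,dt<\infty,\qquad \int_0^\infty e^{\sigma(t)-\kappa(t)}\,dt<\infty.$$ Furthermore, suppose there is an analytic function $P$ on $T^R$ such that $$C_1e^{\sigma(x)}\le|P(z)|\le C_2e^{\kappa(x)},\qquad z=x+iy\in T^R,$$ for some $C_1,C_2>0$. If $F\in\mathcal{O}_\omega^{b,R}$ is such that $\operatorname{bv}(F)=0$ on $\mathcal{A}_\sigma^h$, then $F\in\mathcal{P}_\kappa^R$ (that is, $F$ extends analytically to $T^R$ and the extension belongs to $\mathcal{P}_\kappa^R$).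
   Context: A weight function is a non-decreasing function $\omega:[0,\infty)\to[0,\infty)$, always assumed to satisfy $\lim_{t\to\infty}\omega(t)/\log t=\infty$; it is extended to $\mathbb{R}$ by $\omega(t)=\omega(|t|)$. Write $z=x+iy$, $T^h=\mathbb{R}+i(-h,h)$, and, for $0<b<R$, $T^{b,R}=T^R\setminus\overline{T^b}$. For a weight function $\omega$: $\mathcal{A}_\omega^h$ is the Banach space of analytic $\varphi$ on $T^h$ with $\sup_{z\in T^h}|\varphi(z)|e^{\omega(x)}<\infty$; $\mathcal{O}_\omega^{b,R}$ is the Banach space of analytic $F$ on $T^{b,R}$ with $\sup_{z\in T^{b,R}}|F(z)|e^{-\omega(x)}<\infty$; $\mathcal{P}_\omega^R$ is the Banach space of analytic $P$ on $T^R$ with $\sup_{z\in T^R}|P(z)|e^{-\omega(x)}<\infty$. For $0<b<h<R$ and $F\in\mathcal{O}_\omega^{b,R}$, the functional $\operatorname{bv}(F)\in(\mathcal{A}_\sigma^h)'$ is defined by $\langle\operatorname{bv}(F),\varphi\rangle=-\int_{\Gamma_k}F(z)\varphi(z)\,dz$, $\varphi\in\mathcal{A}_\sigma^h$, where $b<k<h$ and $\Gamma_k$ is the counterclockwise oriented boundary of $T^k$ (independent of $k$). *)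

(* Defs.v *)
From Stdlib Require Import Reals.
From Coquelicot Require Import Coquelicot.
Open Scope R_scope.

(* A weight function [0,oo) -> [0,oo) is represented by a function R -> R of
   which only the values on [0,oo) matter; its even extension to R is
   [fun x => w (Rabs x)]. *)
Definition weight_function (w : R -> R) : Prop :=
  (forall t, 0 <= t -> 0 <= w t) /\
  (forall s t, 0 <= s -> s <= t -> w s <= w t) /\
  is_lim (fun t => w t / ln t) p_infty p_infty.

Definition int_0_infty_finite (f : R -> R) : Prop :=
  ex_RInt_gen f (at_point 0) (Rbar_locally p_infty).

Definition strip (h : R) (z : C) : Prop := - h < Im z < h.

(* The closure of [strip b] is { |Im z| <= b } (for b > 0). *)
Definition strip_diff (b r : R) (z : C) : Prop :=
  strip r z /\ ~ (- b <= Im z <= b).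

(* Only used for open sets D: a function C -> C stands for its restriction
   to D, and [ex_derive] over C is complex differentiability. *)
Definition analytic_on (D : C -> Prop) (f : C -> C) : Prop :=
  forall z, D z -> @ex_derive C_AbsRing C_NormedModule f z.

Definition space_A (w : R -> R) (h : R) (phi : C -> C) : Prop :=
  analytic_on (strip h) phi /\
  exists M : R, forall z, strip h z -> Cmod (phi z) * exp (w (Rabs (Re z))) <= M.

Definition space_O (w : R -> R) (b r : R) (F : C -> C) : Prop :=
  analytic_on (strip_diff b r) F /\
  exists M : R, forall z, strip_diff b r z ->
    Cmod (F z) * exp (- w (Rabs (Re z))) <= M.

Definition space_P (w : R -> R) (r : R) (P : C -> C) : Prop :=
  analytic_on (strip r) P /\
  exists M : R, forall z, strip r z ->
    Cmod (P z) * exp (- w (Rabs (Re z))) <= M.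

Definition line_integral (y : R) (f : C -> C) : C :=
  @RInt_gen C_R_CompleteNormedModule (fun x : R => f (x, y))
    (Rbar_locally m_infty) (Rbar_locally p_infty).

(* Counterclockwise: R - ik from left to right, R + ik from right to left. *)
Definition boundary_integral (k : R) (f : C -> C) : C :=
  (line_integral (- k) f - line_integral k f)%C.

(* Meant for b < k < h, F in [space_O w b r] and phi in [space_A s h] with
   exp (w - s) integrable: the integrals then converge absolutely and the value
   does not depend on k. *)
Definition bv (k : R) (F phi : C -> C) : C :=
  (- boundary_integral k (fun z => F z * phi z))%C.

(* Main.v *)
Require Import Defs.
From Stdlib Require Import Reals Lra.
From Coquelicot Require Import Coquelicot.
Open Scope R_scope.

(** Divide by [P]: on the two half strips the function [f = F / P] is bounded by
    a multiple of [exp (omega (Re z) - sigma (Re z))], which is integrable on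
    horizontal lines and tends to 0 at both ends.  So Cauchy's theorem and
    Cauchy's formula hold for [f] on infinite closed strips
    ([cauchy_strip], [cauchy_formula_strip]), and the Cauchy integral
    [K w = int_(Gamma_h) f z / (z - w) dz] is analytic on [|Im w| < h]
    ([Cdiff_line_cauchy_integral]).  The extension of [F] is [P * K / (2 PI i)].

    It agrees with [F] at [w] as soon as [int_(Gamma_k0) f z / (z - w) dz = 0] for
    some [k0] between [b] and [|Im w|]: Cauchy's formula between [Gamma_k0] and
    [Gamma_h] then gives [K w = 2 PI i f w] ([boundary_integral_kernel_inside]).
    If [|Im w| > h], this vanishing is, up to a shift of the contour, the
    hypothesis [bv F = 0] applied to
    [phi z = 1 / (P z (z - w))], which lies in the test space because
    [|1 / P| <= exp (- sigma) / C1].  For [|Im w| <= h] this [phi] has a pole in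
    the strip.  It is therefore replaced by the partial sums of the expansion of
    [1 / (z - w)] in powers of [(w - z1) / (z - z1)], with [z1] a translate of
    [w], vertically away from the strip, with [|Im z1| > h]: these partial sums
    divided by [P] are test functions, and since [Gamma_k0] is farther from [z1]
    than [w] is, they converge geometrically to [1 / (z - w)] on [Gamma_k0]
    ([boundary_integral_kernel_outside]).

    The growth bound holds because [|P| <= C2 exp kappa] and [K] is bounded on
    [|Im w| <= b], while for [|Im w| > b] the weight [omega] exceeds [sigma], and
    [sigma] exceeds [kappa], at most by a constant.

    The Cauchy theory is built from pointwise complex differentiability:
    Goursat's theorem by quadrisection of rectangles, then Cauchy's formula by
    shrinking the contour to a small square around the singularity. *)

(** * Complex differentiability *)

Notation Cdiff f z := (@ex_derive C_AbsRing C_NormedModule f z).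
Notation is_Cderive f z l := (@is_derive C_AbsRing C_NormedModule f z l).

Lemma is_Cderive_eps (f : C -> C) (z l : C) :
  is_Cderive f z l <->
  forall eps, 0 < eps -> exists delta, 0 < delta /\
    forall w, Cmod (w - z) < delta ->
      Cmod (f w - f z - (w - z) * l) <= eps * Cmod (w - z).
Proof.
  split.
  - intros [_ H] eps Heps.
    destruct (H z (fun P HP => HP) (mkposreal eps Heps)) as [delta Hd].
    exists delta; split; [apply cond_pos|].
    intros w Hw; exact (Hd w Hw).
  - intros H; split; [apply is_linear_scal_l|].
    intros x Hx.
    assert (E : z = x) by exact (is_filter_lim_locally_unique _ _ Hx).
    subst x.
    intros eps. destruct (H eps (cond_pos eps)) as (delta & Hdelta & Hd).
    exists (mkposreal delta Hdelta). intros w Hw. exact (Hd w Hw).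
Qed.

(** Both normed modules on [C] give the same notion of derivative; this lemma
    transfers the product and chain rules, which are stated for the module that
    comes from the absolute-value ring. *)
Lemma is_Cderive_ring (f : C -> C) (z l : C) :
  is_Cderive f z l <-> @is_derive C_AbsRing (AbsRing_NormedModule C_AbsRing) f z l.
Proof. split; intros [_ H]; (split; [apply is_linear_scal_l | exact H]). Qed.

Lemma is_Cderive_mult (f g : C -> C) z f' g' :
  is_Cderive f z f' -> is_Cderive g z g' ->
  is_Cderive (fun z => (f z * g z)%C) z (f' * g z + f z * g')%C.
Proof.
  intros Hf Hg. rewrite is_Cderive_ring in Hf, Hg |- *.
  exact (@is_derive_mult C_AbsRing f g z f' g' Hf Hg Cmult_comm).
Qed.

Lemma Cdiff_mult (f g : C -> C) z :
  Cdiff f z -> Cdiff g z -> Cdiff (fun z => (f z * g z)%C) z.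
Proof.
  intros [f' Hf] [g' Hg]. exists (f' * g z + f z * g')%C. now apply is_Cderive_mult.
Qed.

Lemma Cdiff_plus (f g : C -> C) z :
  Cdiff f z -> Cdiff g z -> Cdiff (fun z => (f z + g z)%C) z.
Proof. exact (@ex_derive_plus C_AbsRing C_NormedModule f g z). Qed.

Lemma Cdiff_minus (f g : C -> C) z :
  Cdiff f z -> Cdiff g z -> Cdiff (fun z => (f z - g z)%C) z.
Proof. exact (@ex_derive_minus C_AbsRing C_NormedModule f g z). Qed.

Lemma Cdiff_const (c z : C) : Cdiff (fun _ => c) z.
Proof. exact (@ex_derive_const C_AbsRing C_NormedModule c z). Qed.

Lemma Cdiff_id (z : C) : Cdiff (fun z => z) z.
Proof.
  exists (RtoC 1). apply is_Cderive_ring. exact (@is_derive_id C_AbsRing z).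
Qed.

Lemma Cminus_0_neq (z w : C) : z <> w -> (z - w)%C <> 0.
Proof. intros H E; apply H. now apply Ceq_minus. Qed.

Lemma Cmod_minus_sym (z w : C) : Cmod (z - w) = Cmod (w - z).
Proof. rewrite <- Cmod_opp. f_equal. ring. Qed.

Lemma Cmod_triangle_inv (z w : C) : Cmod z - Cmod w <= Cmod (z - w).
Proof.
  generalize (Cmod_triangle (z - w) w).
  replace (z - w + w)%C with z by ring. lra.
Qed.

Lemma Cmod_minus_triangle (z w : C) : Cmod (z - w) <= Cmod z + Cmod w.
Proof. rewrite <- (Cmod_opp w). apply Cmod_triangle. Qed.

Lemma is_Cderive_Cinv (z : C) : z <> 0 -> is_Cderive Cinv z (- / (z * z))%C.
Proof.
  intros Hz. apply is_Cderive_eps. intros eps Heps.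
  assert (Hm : 0 < Cmod z) by now apply Cmod_gt_0.
  set (m := Cmod z) in *.
  exists (Rmin (m / 2) (eps * (m * m * m) / 2)).
  assert (0 < m * m * m) by (repeat apply Rmult_lt_0_compat; lra).
  split; [apply Rmin_pos; [lra | apply Rdiv_lt_0_compat; [nra|lra]]|].
  intros w Hw.
  assert (H1 : Cmod (w - z) < m / 2) by (eapply Rlt_le_trans; [apply Hw| apply Rmin_l]).
  assert (H2 : Cmod (w - z) < eps * (m * m * m) / 2)
    by (eapply Rlt_le_trans; [apply Hw| apply Rmin_r]).
  assert (Hwm : m / 2 < Cmod w).
  { generalize (Cmod_triangle_inv z w). rewrite Cmod_minus_sym. fold m. lra. }
  assert (Hw0 : w <> 0) by (apply Cmod_gt_0; lra).
  replace (/ w - / z - (w - z) * - / (z * z))%C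
    with ((w - z) * ((w - z) / (w * (z * z))))%C by (field; auto).
  rewrite Cmod_mult, Cmod_div by (repeat apply Cmult_neq_0; auto).
  rewrite !Cmod_mult. fold m. rewrite Rmult_comm.
  apply Rmult_le_compat_r; [apply Cmod_ge_0|].
  apply Rle_div_l; [apply Rmult_lt_0_compat; nra|].
  apply Rle_trans with (1 := Rlt_le _ _ H2).
  assert (m * m * (m / 2) <= m * m * Cmod w) by (apply Rmult_le_compat_l; nra).
  nra.
Qed.

Lemma Cdiff_inv (g : C -> C) z : Cdiff g z -> g z <> 0 -> Cdiff (fun z => / g z)%C z.
Proof.
  intros [g' Hg] Hz. eexists.
  rewrite is_Cderive_ring in Hg.
  exact (@is_derive_comp C_AbsRing C_NormedModule Cinv g z _ _ (is_Cderive_Cinv _ Hz) Hg).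
Qed.

Lemma Cdiff_kernel (c z : C) : z <> c -> Cdiff (fun z => / (z - c))%C z.
Proof.
  intros H. apply Cdiff_inv; [apply Cdiff_minus; [apply Cdiff_id|apply Cdiff_const]|].
  now apply Cminus_0_neq.
Qed.

Lemma Cdiff_eps_continuous (f : C -> C) z : Cdiff f z ->
  forall eps, 0 < eps -> exists delta, 0 < delta /\
    forall w, Cmod (w - z) < delta -> Cmod (f w - f z) < eps.
Proof.
  intros H eps Heps.
  assert (Hc := @ex_derive_continuous C_AbsRing C_NormedModule f z H).
  assert (He : 0 < eps / sqrt 2) by (apply Rdiv_lt_0_compat; [lra|apply Rlt_sqrt2_0]).
  destruct (Hc _ (locally_ball (f z : C_UniformSpace) (mkposreal _ He))) as [delta Hd].
  exists delta. split; [apply cond_pos|].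
  intros w Hw. specialize (Hd w Hw).
  apply (C_NormedModule_mixin_compat2 (f z) (f w)) in Hd. simpl in Hd.
  replace eps with (sqrt 2 * (eps / sqrt 2)); [exact Hd|].
  field. apply Rgt_not_eq, Rlt_sqrt2_0.
Qed.

(** Stated for paths that do not increase distances, so that one proof serves the
    horizontal and the vertical sides of rectangles. *)
Lemma Cdiff_continuous_line (f : C -> C) (p : R -> C) (x : R) :
  (forall s, Cmod (p s - p x) <= Rabs (s - x)) -> Cdiff f (p x) ->
  @continuous R_UniformSpace C_R_NormedModule (fun s => f (p s)) x.
Proof.
  intros Hp Hf.
  apply filterlim_locally. intros eps.
  destruct (Cdiff_eps_continuous f (p x) Hf eps (cond_pos eps)) as (delta & Hdelta & Hd).
  exists (mkposreal delta Hdelta). intros s Hs.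
  apply (C_NormedModule_mixin_compat1 (f (p x)) (f (p s))).
  apply Hd. apply Rle_lt_trans with (1 := Hp s). exact Hs.
Qed.

Lemma Cdiff_continuous_h (f : C -> C) (x y : R) : Cdiff f (x, y) ->
  @continuous R_UniformSpace C_R_NormedModule (fun s => f (s, y)) x.
Proof.
  apply (Cdiff_continuous_line f (fun s => (s, y))).
  intros s. replace ((s, y) - (x, y))%C with (RtoC (s - x)).
  rewrite Cmod_R; lra.
  apply injective_projections; simpl; ring.
Qed.

Lemma Cdiff_continuous_v (f : C -> C) (x y : R) : Cdiff f (x, y) ->
  @continuous R_UniformSpace C_R_NormedModule (fun s => f (x, s)) y.
Proof.
  apply (Cdiff_continuous_line f (fun s => (x, s))).
  intros s. replace ((x, s) - (x, y))%C with (Ci * RtoC (s - y))%C.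
  rewrite Cmod_mult, Cmod_Ci, Cmod_R; lra.
  apply injective_projections; simpl; ring.
Qed.

(** * Contour integrals over rectangles *)

Notation RIntC f a b := (@RInt C_R_CompleteNormedModule f a b).
Notation is_RIntC f a b l := (@is_RInt C_R_NormedModule f a b l).
Notation ex_RIntC f a b := (@ex_RInt C_R_NormedModule f a b).

Lemma RIntC_correct (f : R -> C) a b : ex_RIntC f a b -> is_RIntC f a b (RIntC f a b).
Proof. exact (@RInt_correct C_R_CompleteNormedModule f a b). Qed.

Lemma is_RIntC_unique (f : R -> C) a b l : is_RIntC f a b l -> RIntC f a b = l.
Proof. exact (@is_RInt_unique C_R_CompleteNormedModule f a b l). Qed.

(** The integral is one over a real module, so only real scalars can be taken out
    directly; a complex factor is handled on real and imaginary parts. *)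
Lemma is_RIntC_Cmult (c : C) (f : R -> C) a b l :
  is_RIntC f a b l -> is_RIntC (fun x => (c * f x)%C) a b (c * l)%C.
Proof.
  intros H.
  assert (H1 := @is_RInt_fct_extend_fst R_NormedModule R_NormedModule f a b l H).
  assert (H2 := @is_RInt_fct_extend_snd R_NormedModule R_NormedModule f a b l H).
  apply (@is_RInt_fct_extend_pair R_NormedModule R_NormedModule).
  - exact (is_RInt_minus _ _ _ _ _ _ (is_RInt_scal _ _ _ (fst c) _ H1)
             (is_RInt_scal _ _ _ (snd c) _ H2)).
  - exact (is_RInt_plus _ _ _ _ _ _ (is_RInt_scal _ _ _ (fst c) _ H2)
             (is_RInt_scal _ _ _ (snd c) _ H1)).
Qed.

Lemma RIntC_Cmult (c : C) (f : R -> C) a b :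
  ex_RIntC f a b -> RIntC (fun x => (c * f x)%C) a b = (c * RIntC f a b)%C.
Proof. intros H. apply is_RIntC_unique, is_RIntC_Cmult, RIntC_correct, H. Qed.

Lemma Cmod_RIntC_le (f : R -> C) a b M : a <= b -> ex_RIntC f a b ->
  (forall x, a <= x <= b -> Cmod (f x) <= M) -> Cmod (RIntC f a b) <= (b - a) * M.
Proof.
  intros Hab Hex HM. rewrite Cmod_norm.
  assert (HM' : forall x, a <= x <= b -> @norm R_AbsRing C_R_NormedModule (f x) <= M).
  { intros x Hx. change (@norm R_AbsRing C_R_NormedModule (f x)) with
      (@norm R_AbsRing (prod_NormedModule R_AbsRing R_NormedModule R_NormedModule) (f x)).
    rewrite <- Cmod_norm. now apply HM. }
  exact (@norm_RInt_le_const C_R_NormedModule f a b _ M Hab HM' (RIntC_correct _ _ _ Hex)).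
Qed.

Lemma ex_RIntC_h (g : C -> C) x0 x1 y : x0 <= x1 ->
  (forall x, x0 <= x <= x1 -> Cdiff g (x, y)) -> ex_RIntC (fun x => g (x, y)) x0 x1.
Proof.
  intros H01 H. apply (@ex_RInt_continuous C_R_CompleteNormedModule).
  intros x. rewrite Rmin_left, Rmax_right by easy. intros Hx.
  now apply (Cdiff_continuous_h g), H.
Qed.

Lemma ex_RIntC_v (g : C -> C) x y0 y1 : y0 <= y1 ->
  (forall y, y0 <= y <= y1 -> Cdiff g (x, y)) -> ex_RIntC (fun y => g (x, y)) y0 y1.
Proof.
  intros H01 H. apply (@ex_RInt_continuous C_R_CompleteNormedModule).
  intros y. rewrite Rmin_left, Rmax_right by easy. intros Hy.
  now apply (Cdiff_continuous_v g), H.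
Qed.

(** Counterclockwise contour integral over the boundary of
    [[x0, x1] x [y0, y1]]; the factors [Ci] are [dz / dy] on the vertical sides. *)
Definition rect_integral (g : C -> C) (x0 x1 y0 y1 : R) : C :=
  (RIntC (fun x => g (x, y0)) x0 x1 + Ci * RIntC (fun y => g (x1, y)) y0 y1
   - RIntC (fun x => g (x, y1)) x0 x1 - Ci * RIntC (fun y => g (x0, y)) y0 y1)%C.

Definition on_edges (Q : C -> Prop) (x0 x1 y0 y1 : R) : Prop :=
  (forall x, x0 <= x <= x1 -> Q (x, y0) /\ Q (x, y1)) /\
  (forall y, y0 <= y <= y1 -> Q (x0, y) /\ Q (x1, y)).

Definition on_rect (Q : C -> Prop) (x0 x1 y0 y1 : R) : Prop :=
  forall x y, x0 <= x <= x1 -> y0 <= y <= y1 -> Q (x, y).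

Lemma on_rect_edges Q x0 x1 y0 y1 : x0 <= x1 -> y0 <= y1 ->
  on_rect Q x0 x1 y0 y1 -> on_edges Q x0 x1 y0 y1.
Proof. intros Hx Hy H; split; intros t Ht; split; apply H; lra. Qed.

Lemma on_edges_imp (Q Q' : C -> Prop) x0 x1 y0 y1 : (forall z, Q z -> Q' z) ->
  on_edges Q x0 x1 y0 y1 -> on_edges Q' x0 x1 y0 y1.
Proof. intros H [H1 H2]; split; intros t Ht; split; apply H; now apply H1 || apply H2. Qed.

Lemma ex_RIntC_edges (g : C -> C) x0 x1 y0 y1 : x0 <= x1 -> y0 <= y1 ->
  on_edges (fun z => Cdiff g z) x0 x1 y0 y1 ->
  ex_RIntC (fun x => g (x, y0)) x0 x1 /\ ex_RIntC (fun y => g (x1, y)) y0 y1 /\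
  ex_RIntC (fun x => g (x, y1)) x0 x1 /\ ex_RIntC (fun y => g (x0, y)) y0 y1.
Proof.
  intros Hx Hy [H1 H2].
  repeat apply conj.
  - exact (ex_RIntC_h g x0 x1 y0 Hx (fun t Ht => proj1 (H1 t Ht))).
  - exact (ex_RIntC_v g x1 y0 y1 Hy (fun t Ht => proj2 (H2 t Ht))).
  - exact (ex_RIntC_h g x0 x1 y1 Hx (fun t Ht => proj2 (H1 t Ht))).
  - exact (ex_RIntC_v g x0 y0 y1 Hy (fun t Ht => proj1 (H2 t Ht))).
Qed.

Lemma rect_integral_minus (f g : C -> C) x0 x1 y0 y1 : x0 <= x1 -> y0 <= y1 ->
  on_edges (fun z => Cdiff f z) x0 x1 y0 y1 ->
  on_edges (fun z => Cdiff g z) x0 x1 y0 y1 ->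
  rect_integral (fun z => f z - g z)%C x0 x1 y0 y1
  = (rect_integral f x0 x1 y0 y1 - rect_integral g x0 x1 y0 y1)%C.
Proof.
  intros Hx Hy Hf Hg.
  destruct (ex_RIntC_edges _ _ _ _ _ Hx Hy Hf) as (F1 & F2 & F3 & F4).
  destruct (ex_RIntC_edges _ _ _ _ _ Hx Hy Hg) as (G1 & G2 & G3 & G4).
  unfold rect_integral.
  assert (E : forall u v a b, ex_RIntC u a b -> ex_RIntC v a b ->
    RIntC (fun x => u x - v x)%C a b = (RIntC u a b - RIntC v a b)%C)
    by exact (@RInt_minus C_R_CompleteNormedModule).
  rewrite !E by assumption. ring.
Qed.

Lemma rect_integral_le (g : C -> C) x0 x1 y0 y1 M : x0 <= x1 -> y0 <= y1 ->
  on_edges (fun z => Cdiff g z) x0 x1 y0 y1 ->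
  on_edges (fun z => Cmod (g z) <= M) x0 x1 y0 y1 ->
  Cmod (rect_integral g x0 x1 y0 y1) <= 2 * ((x1 - x0) + (y1 - y0)) * M.
Proof.
  intros Hx Hy Hg [M1 M2].
  destruct (ex_RIntC_edges _ _ _ _ _ Hx Hy Hg) as (G1 & G2 & G3 & G4).
  unfold rect_integral.
  assert (L1 := Cmod_RIntC_le _ _ _ M Hx G1 (fun t Ht => proj1 (M1 t Ht))).
  assert (L2 := Cmod_RIntC_le _ _ _ M Hy G2 (fun t Ht => proj2 (M2 t Ht))).
  assert (L3 := Cmod_RIntC_le _ _ _ M Hx G3 (fun t Ht => proj2 (M1 t Ht))).
  assert (L4 := Cmod_RIntC_le _ _ _ M Hy G4 (fun t Ht => proj1 (M2 t Ht))).
  eapply Rle_trans; [apply Cmod_minus_triangle|].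
  eapply Rle_trans; [apply Rplus_le_compat_r, Cmod_minus_triangle|].
  eapply Rle_trans; [apply Rplus_le_compat_r, Rplus_le_compat_r, Cmod_triangle|].
  rewrite !Cmod_mult, Cmod_Ci. lra.
Qed.

Lemma RIntC_Chasles (f : R -> C) a b c : ex_RIntC f a b -> ex_RIntC f b c ->
  (RIntC f a b + RIntC f b c)%C = RIntC f a c.
Proof. exact (@RInt_Chasles C_R_CompleteNormedModule f a b c). Qed.

Lemma rect_integral_split_h (g : C -> C) x0 x1 x2 y0 y1 : x0 <= x1 -> x1 <= x2 ->
  (forall x, x0 <= x <= x2 -> Cdiff g (x, y0) /\ Cdiff g (x, y1)) ->
  rect_integral g x0 x2 y0 y1
  = (rect_integral g x0 x1 y0 y1 + rect_integral g x1 x2 y0 y1)%C.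
Proof.
  intros H01 H12 H. unfold rect_integral.
  assert (H' : forall a b, x0 <= a -> a <= b -> b <= x2 ->
    ex_RIntC (fun x => g (x, y0)) a b /\ ex_RIntC (fun x => g (x, y1)) a b).
  { intros a b Ha Hab Hb; split.
    - exact (ex_RIntC_h g a b y0 Hab (fun t Ht => proj1 (H t ltac:(lra)))).
    - exact (ex_RIntC_h g a b y1 Hab (fun t Ht => proj2 (H t ltac:(lra)))). }
  rewrite <- (RIntC_Chasles (fun x => g (x, y0)) x0 x1 x2) by (apply (fun a b p q r => proj1 (H' a b p q r)); lra).
  rewrite <- (RIntC_Chasles (fun x => g (x, y1)) x0 x1 x2) by (apply (fun a b p q r => proj2 (H' a b p q r)); lra).
  ring.
Qed.

Lemma rect_integral_split_v (g : C -> C) x0 x1 y0 y1 y2 : y0 <= y1 -> y1 <= y2 ->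
  (forall y, y0 <= y <= y2 -> Cdiff g (x0, y) /\ Cdiff g (x1, y)) ->
  rect_integral g x0 x1 y0 y2
  = (rect_integral g x0 x1 y0 y1 + rect_integral g x0 x1 y1 y2)%C.
Proof.
  intros H01 H12 H. unfold rect_integral.
  assert (H' : forall a b, y0 <= a -> a <= b -> b <= y2 ->
    ex_RIntC (fun y => g (x0, y)) a b /\ ex_RIntC (fun y => g (x1, y)) a b).
  { intros a b Ha Hab Hb; split.
    - exact (ex_RIntC_v g x0 a b Hab (fun t Ht => proj1 (H t ltac:(lra)))).
    - exact (ex_RIntC_v g x1 a b Hab (fun t Ht => proj2 (H t ltac:(lra)))). }
  rewrite <- (RIntC_Chasles (fun y => g (x0, y)) y0 y1 y2) by (apply (fun a b p q r => proj1 (H' a b p q r)); lra).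
  rewrite <- (RIntC_Chasles (fun y => g (x1, y)) y0 y1 y2) by (apply (fun a b p q r => proj2 (H' a b p q r)); lra).
  ring.
Qed.

(** Chain rule along a line of unit direction [u]. *)
Lemma is_derive_path (A : C -> C) (p : R -> C) (u l : C) (x : R) :
  (forall s, (p s - p x)%C = (RtoC (s - x) * u)%C) -> Cmod u = 1 ->
  is_Cderive A (p x) l ->
  @is_derive R_AbsRing C_R_NormedModule (fun s => A (p s)) x (u * l)%C.
Proof.
  intros Hp Hu HA. rewrite is_Cderive_eps in HA.
  split; [apply is_linear_scal_l|].
  intros x' Hx. assert (E : x = x') by exact (is_filter_lim_locally_unique _ _ Hx).
  subst x'. intros eps.
  destruct (HA eps (cond_pos eps)) as (delta & Hdelta & Hd).
  exists (mkposreal delta Hdelta). intros s Hs.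
  assert (Hn : Cmod (p s - p x) = Rabs (s - x)).
  { rewrite Hp, Cmod_mult, Hu, Cmod_R. ring. }
  assert (Hs' : Cmod (p s - p x) < delta) by (rewrite Hn; exact Hs).
  specialize (Hd _ Hs'). rewrite Hn in Hd.
  refine (Rle_trans _ _ _ (Req_le _ _ _) Hd).
  etransitivity; [symmetry; apply Cmod_norm|].
  change (Cmod (A (p s) - A (p x) - @scal R_AbsRing C_R_NormedModule (minus s x) (u * l)%C)%C
   = Cmod (A (p s) - A (p x) - (p s - p x) * l)%C).
  rewrite scal_R_Cmult, Hp. f_equal. change (minus s x) with (s - x). ring.
Qed.

Lemma RIntC_primitive_h (A g : C -> C) x0 x1 y : x0 <= x1 ->
  (forall x, x0 <= x <= x1 -> is_Cderive A (x, y) (g (x, y))) ->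
  (forall x, x0 <= x <= x1 -> Cdiff g (x, y)) ->
  RIntC (fun x => g (x, y)) x0 x1 = (A (x1, y) - A (x0, y))%C.
Proof.
  intros H01 HA Hg. apply is_RIntC_unique.
  apply (@is_RInt_derive C_R_CompleteNormedModule (fun x => A (x, y)));
   intros x; rewrite Rmin_left, Rmax_right by easy; intros Hx.
  - replace (g (x, y)) with (1 * g (x, y))%C by ring.
    apply (is_derive_path A (fun s => (s, y))); [|apply Cmod_1|now apply HA].
    intros s. apply injective_projections; simpl; ring.
  - now apply (Cdiff_continuous_h g), Hg.
Qed.

Lemma RIntC_primitive_v (A g : C -> C) x y0 y1 : y0 <= y1 ->
  (forall y, y0 <= y <= y1 -> is_Cderive A (x, y) (g (x, y))) ->
  (forall y, y0 <= y <= y1 -> Cdiff g (x, y)) ->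
  (Ci * RIntC (fun y => g (x, y)) y0 y1)%C = (A (x, y1) - A (x, y0))%C.
Proof.
  intros H01 HA Hg. rewrite <- RIntC_Cmult by now apply (ex_RIntC_v g).
  apply is_RIntC_unique.
  apply (@is_RInt_derive C_R_CompleteNormedModule (fun y => A (x, y)));
   intros y; rewrite Rmin_left, Rmax_right by easy; intros Hy.
  - apply (is_derive_path A (fun s => (x, s))); [|apply Cmod_Ci|now apply HA].
    intros s. apply injective_projections; simpl; ring.
  - apply (Cdiff_continuous_v (fun z => (Ci * g z)%C)).
    apply Cdiff_mult; [apply Cdiff_const|now apply Hg].
Qed.

(** An affine function has the quadratic primitive [A], so its integral telescopes
    around the rectangle.  This is what makes the differentiability estimate of
    Goursat's theorem work. *)
Lemma rect_integral_affine (c d p : C) x0 x1 y0 y1 : x0 <= x1 -> y0 <= y1 ->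
  rect_integral (fun z => c + (z - p) * d)%C x0 x1 y0 y1 = 0.
Proof.
  intros Hx Hy. set (g := fun z => (c + (z - p) * d)%C).
  set (A := fun z : C => (z * c + z * z * (d / 2) - z * (p * d))%C).
  assert (H2 : RtoC 2 <> 0) by (intros E; apply RtoC_inj in E; lra).
  assert (HA : forall z, is_Cderive A z (g z)).
  { intros z. apply is_Cderive_eps. intros eps Heps.
    destruct (Req_dec (Cmod d) 0) as [Hd|Hd].
    - exists 1; split; [lra|]. intros w _. unfold A, g.
      apply Cmod_eq_0 in Hd. rewrite Hd.
      match goal with |- Cmod ?t <= _ => replace t with (RtoC 0) by (field; auto) end.
      rewrite Cmod_0. apply Rmult_le_pos; [lra|apply Cmod_ge_0].
    - assert (Hd' : 0 < Cmod d) by (generalize (Cmod_ge_0 d); lra).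
      exists (eps / Cmod d); split; [now apply Rdiv_lt_0_compat|].
      intros w Hw. unfold A, g.
      match goal with |- Cmod ?t <= _ =>
        replace t with ((w - z) * ((w - z) * (d / 2)))%C by (field; auto) end.
      rewrite !Cmod_mult, Cmod_div, Cmod_R, Rabs_right by (auto; lra).
      rewrite Rmult_comm. apply Rmult_le_compat_r; [apply Cmod_ge_0|].
      apply (Rlt_div_r _ _ _ Hd') in Hw. generalize (Cmod_ge_0 (w - z)). nra. }
  assert (Hg : forall z, Cdiff g z).
  { intros z. apply Cdiff_plus; [apply Cdiff_const|].
    apply Cdiff_mult; [|apply Cdiff_const].
    apply Cdiff_minus; [apply Cdiff_id | apply Cdiff_const]. }
  unfold rect_integral.
  rewrite !(RIntC_primitive_h A g), !(RIntC_primitive_v A g) by auto.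
  ring.
Qed.

(** * Goursat's theorem *)

Lemma nested_intervals (a : nat -> R) (w : R) : 0 <= w ->
  (forall n, a n <= a (S n) /\ a (S n) + w / 2 ^ S n <= a n + w / 2 ^ n) ->
  exists c, forall n, a n <= c <= a n + w / 2 ^ n.
Proof.
  intros Hw Ha.
  assert (Hpos : forall n, 0 <= w / 2 ^ n).
  { intros n. apply Rdiv_le_0_compat; [easy|apply pow_lt; lra]. }
  assert (Hup : forall n k, a n <= a (k + n)%nat /\
     a (k + n)%nat + w / 2 ^ (k + n) <= a n + w / 2 ^ n).
  { intros n k; induction k as [|k IH]; [change (0 + n)%nat with n; lra|].
    change (S k + n)%nat with (S (k + n)). generalize (Ha (k + n)%nat). lra. }
  assert (Hle : forall m n, a m <= a n + w / 2 ^ n).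
  { intros m n. destruct (Nat.le_ge_cases m n) as [H|H].
    - generalize (Hup m (n - m)%nat) (Hpos n). rewrite Nat.sub_add by easy. lra.
    - generalize (Hup n (m - n)%nat) (Hpos m). rewrite Nat.sub_add by easy. lra. }
  destruct (completeness (fun x => exists n, x = a n)) as [c [Hc1 Hc2]].
  - exists (a O + w / 2 ^ 0). intros x [n ->]. apply Hle.
  - exists (a O); now exists O.
  - exists c. intros n; split.
    + apply Hc1; now exists n.
    + apply Hc2. intros x [m ->]. apply Hle.
Qed.

Section Goursat.
Variables (g : C -> C) (x0 y0 w v eps : R).
Hypotheses (Hw : 0 <= w) (Hv : 0 <= v) (Heps : 0 < eps).
Hypothesis Hg : on_rect (fun z => Cdiff g z) x0 (x0 + w) y0 (y0 + v).

Let inside n (p : R * R) : Prop :=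
  (x0 <= fst p /\ fst p + w / 2 ^ n <= x0 + w) /\
  (y0 <= snd p /\ snd p + v / 2 ^ n <= y0 + v).

Let bad n (p : R * R) : Prop :=
  eps * (w / 2 ^ n + v / 2 ^ n) ^ 2 <
  Cmod (rect_integral g (fst p) (fst p + w / 2 ^ n) (snd p) (snd p + v / 2 ^ n)).

Let nested n (p p' : R * R) : Prop :=
  (fst p <= fst p' /\ fst p' + w / 2 ^ S n <= fst p + w / 2 ^ n) /\
  (snd p <= snd p' /\ snd p' + v / 2 ^ S n <= snd p + v / 2 ^ n).

(** The four quarters of a rectangle have contour integrals that add up to that of
    the rectangle, and the square of the half perimeter is also divided by four;
    so if the bound fails on a rectangle it fails on a quarter.  The result is a
    sigma type so that the quarters can be chosen recursively. *)
Lemma goursat_step n p : inside n p /\ bad n p ->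
  { p' | (inside (S n) p' /\ bad (S n) p') /\ nested n p p' }.
Proof.
  intros [Hin Hbad]. destruct p as [x y].
  set (w' := w / 2 ^ S n). set (v' := v / 2 ^ S n).
  assert (Ew : w / 2 ^ n = w' + w').
  { unfold w'. simpl. field. apply pow_nonzero; lra. }
  assert (Ev : v / 2 ^ n = v' + v').
  { unfold v'. simpl. field. apply pow_nonzero; lra. }
  assert (Hw' : 0 <= w') by (apply Rdiv_le_0_compat; [easy|apply pow_lt; lra]).
  assert (Hv' : 0 <= v') by (apply Rdiv_le_0_compat; [easy|apply pow_lt; lra]).
  unfold inside, bad, nested in *. fold w' v'. cbn [fst snd] in *.
  rewrite Ew, Ev in *.
  assert (D : forall p : R * R, { eps * (w' + v') ^ 2 <
     Cmod (rect_integral g (fst p) (fst p + w') (snd p) (snd p + v')) } +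
     { ~ eps * (w' + v') ^ 2 <
     Cmod (rect_integral g (fst p) (fst p + w') (snd p) (snd p + v')) })
    by (intros p; apply Rlt_dec).
  destruct (D (x, y)) as [H1|H1]; [exists (x, y); cbn [fst snd]; split; [split; [lra | exact H1]|lra]|].
  destruct (D (x + w', y)) as [H2|H2];
    [exists (x + w', y); cbn [fst snd]; split; [split; [lra | exact H2]|lra]|].
  destruct (D (x, y + v')) as [H3|H3];
    [exists (x, y + v'); cbn [fst snd]; split; [split; [lra | exact H3]|lra]|].
  destruct (D (x + w', y + v')) as [H4|H4];
    [exists (x + w', y + v'); cbn [fst snd]; split; [split; [lra | exact H4]|lra]|].
  exfalso. cbn [fst snd] in *.
  apply Rnot_lt_le in H1, H2, H3, H4.
  apply (Rlt_not_le _ _ Hbad).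
  rewrite (rect_integral_split_h g x (x + w') (x + (w' + w')));
    [|lra|lra|intros t Ht; split; apply Hg; lra].
  rewrite (rect_integral_split_v g x (x + w') y (y + v') (y + (v' + v')));
    [|lra|lra|intros t Ht; split; apply Hg; lra].
  rewrite (rect_integral_split_v g (x + w') (x + (w' + w')) y (y + v') (y + (v' + v')));
    [|lra|lra|intros t Ht; split; apply Hg; lra].
  rewrite <- (Rplus_assoc x w' w'), <- (Rplus_assoc y v' v').
  eapply Rle_trans; [apply Cmod_triangle|].
  eapply Rle_trans; [apply Rplus_le_compat; apply Cmod_triangle|].
  nra.
Qed.

(** Iterating the quadrisection gives bad rectangles shrinking to a point.  At that
    point the function differs from its affine approximation, whose integral is 0,
    by at most [eps / 2] times the distance, and so the small rectangles are not
    bad. *)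
Lemma goursat_estimate :
  Cmod (rect_integral g x0 (x0 + w) y0 (y0 + v)) <= eps * (w + v) ^ 2.
Proof.
  apply Rnot_lt_le. intros Hbad.
  assert (E0 : forall t, t / 2 ^ 0 = t) by (intros; simpl; field).
  assert (H0 : inside 0 (x0, y0) /\ bad 0 (x0, y0)).
  { unfold inside, bad; cbn [fst snd]. rewrite !E0. split; [lra|exact Hbad]. }
  pose (sq := fix sq n : { p | inside n p /\ bad n p } :=
    match n with
    | O => exist _ (x0, y0) H0
    | S n => let (p, Hp) := sq n in
             let (p', Hp') := goursat_step n p Hp in exist _ p' (proj1 Hp')
    end).
  assert (Hn : forall n, nested n (proj1_sig (sq n)) (proj1_sig (sq (S n)))).
  { intros n. simpl. destruct (sq n) as [p Hp]. destruct (goursat_step n p Hp) as [p' Hp'].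
    exact (proj2 Hp'). }
  destruct (nested_intervals (fun n => fst (proj1_sig (sq n))) w Hw) as [cx Hcx].
  { intros n. exact (proj1 (Hn n)). }
  destruct (nested_intervals (fun n => snd (proj1_sig (sq n))) v Hv) as [cy Hcy].
  { intros n. exact (proj2 (Hn n)). }
  assert (Hc : Cdiff g (cx, cy)).
  { generalize (Hcx O) (Hcy O). simpl. rewrite !Rdiv_1_r. intros; now apply Hg. }
  destruct Hc as [l Hl]. rewrite is_Cderive_eps in Hl.
  (* a contour is twice as long as the half perimeter, hence the factor 1/2 *)
  destruct (Hl (eps / 2)) as (delta & Hdelta & Hd); [lra|].
  assert (Hlim : exists n, w / 2 ^ n + v / 2 ^ n < delta).
  { destruct (pow_lt_1_zero (/ 2)) with (y := delta / (w + v + 1)) as [n Hn'].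
    - rewrite Rabs_right; lra.
    - apply Rdiv_lt_0_compat; lra.
    - exists n. specialize (Hn' n (Nat.le_refl n)).
      assert (0 < (/ 2) ^ n) by (apply pow_lt; lra).
      rewrite Rabs_right in Hn' by lra.
      apply Rlt_div_r in Hn'; [|lra].
      unfold Rdiv. rewrite <- pow_inv. nra. }
  destruct Hlim as [n Hlim].
  specialize (Hcx n). specialize (Hcy n).
  destruct (sq n) as [[x y] [Hin Hb]].
  unfold inside, bad in Hin, Hb. cbn [proj1_sig fst snd] in Hcx, Hcy, Hin, Hb.
  set (w' := w / 2 ^ n) in *. set (v' := v / 2 ^ n) in *.
  assert (Hw' : 0 <= w') by lra. assert (Hv' : 0 <= v') by lra.
  set (aff := fun z => (g (cx, cy) + (z - (cx, cy)) * l)%C).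
  assert (Hgr : on_edges (fun z => Cdiff g z) x (x + w') y (y + v')).
  { apply on_rect_edges; try lra. intros s t Hs Ht; apply Hg; lra. }
  assert (Har : forall z, Cdiff aff z).
  { intros z. apply Cdiff_plus; [apply Cdiff_const|].
    apply Cdiff_mult; [|apply Cdiff_const].
    apply Cdiff_minus; [apply Cdiff_id | apply Cdiff_const]. }
  apply (Rlt_not_le _ _ Hb).
  replace (rect_integral g x (x + w') y (y + v')) with
    (rect_integral (fun z => g z - aff z)%C x (x + w') y (y + v')).
  2:{ rewrite rect_integral_minus; try lra; auto.
      unfold aff at 1. rewrite rect_integral_affine; try lra. ring.
      split; intros; split; apply Har. }
  eapply Rle_trans.
  - apply rect_integral_le with (M := eps / 2 * (w' + v')); try lra.
    + destruct Hgr as [G1 G2]; split; intros t Ht; split; apply Cdiff_minus; auto;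
      now (apply G1 || apply G2).
    + apply on_rect_edges; try lra. intros s t Hs Ht.
      assert (Hdist : Cmod ((s, t) - (cx, cy)) <= w' + v').
      { replace ((s, t) - (cx, cy))%C with (RtoC (s - cx) + Ci * RtoC (t - cy))%C
          by (apply injective_projections; simpl; ring).
        eapply Rle_trans; [apply Cmod_triangle|].
        rewrite Cmod_mult, Cmod_Ci, !Cmod_R, Rmult_1_l.
        apply Rplus_le_compat; apply Rabs_le; lra. }
      replace (g (s, t) - aff (s, t))%C with
        (g (s, t) - g (cx, cy) - ((s, t) - (cx, cy)) * l)%C by (unfold aff; ring).
      eapply Rle_trans; [apply Hd; lra|].
      apply Rmult_le_compat_l; lra.
  - apply Req_le. field.
Qed.
End Goursat.

(** The estimate holds for every [eps], so the integral vanishes. *)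
Theorem goursat (g : C -> C) x0 x1 y0 y1 : x0 <= x1 -> y0 <= y1 ->
  on_rect (fun z => Cdiff g z) x0 x1 y0 y1 -> rect_integral g x0 x1 y0 y1 = 0.
Proof.
  intros Hx Hy Hg. apply Cmod_eq_0.
  apply Rle_antisym; [|apply Cmod_ge_0].
  apply le_epsilon. intros eps Heps. rewrite Rplus_0_l.
  set (L := (x1 - x0) + (y1 - y0)).
  assert (HL : 0 <= L) by (unfold L; lra).
  replace x1 with (x0 + (x1 - x0)) in Hg |- * by ring.
  replace y1 with (y0 + (y1 - y0)) in Hg |- * by ring.
  eapply Rle_trans.
  - apply (goursat_estimate g x0 y0 (x1 - x0) (y1 - y0) (eps / (L ^ 2 + 1))); try lra; auto.
    apply Rdiv_lt_0_compat; nra.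
  - fold L. apply Rle_trans with (eps / (L ^ 2 + 1) * (L ^ 2 + 1)).
    + apply Rmult_le_compat_l; [apply Rlt_le, Rdiv_lt_0_compat; nra | lra].
    + apply Req_le. field. nra.
Qed.

(** * Cauchy's formula on a rectangle *)

Lemma is_RInt_square_odd xi s : 0 < s ->
  is_RInt (fun x => (x - xi) / ((x - xi) ^ 2 + s ^ 2)) (xi - s) (xi + s) 0.
Proof.
  intros Hs.
  assert (Hpos : forall x, 0 < (x - xi) ^ 2 + s ^ 2)
    by (intros x; generalize (pow2_ge_0 (x - xi)); nra).
  evar_last.
  apply (is_RInt_derive (fun x => / 2 * ln ((x - xi) ^ 2 + s ^ 2))).
  - intros x _. specialize (Hpos x). auto_derive; [exact Hpos|]. field. simpl; nra.
  - intros x _. specialize (Hpos x).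
    apply (ex_derive_continuous (fun x => (x - xi) / ((x - xi) ^ 2 + s ^ 2))).
    auto_derive. simpl in Hpos; lra.
  - unfold minus, plus, opp; simpl.
    replace (xi - s - xi) with (- s) by ring. replace (xi + s - xi) with s by ring.
    replace (- s * (- s * 1)) with (s * (s * 1)) by ring. ring.
Qed.

Lemma is_RInt_square_even xi s : 0 < s ->
  is_RInt (fun x => s / ((x - xi) ^ 2 + s ^ 2)) (xi - s) (xi + s) (PI / 2).
Proof.
  intros Hs.
  assert (Hpos : forall x, 0 < (x - xi) ^ 2 + s ^ 2)
    by (intros x; generalize (pow2_ge_0 (x - xi)); nra).
  evar_last.
  apply (is_RInt_derive (fun x => atan ((x - xi) / s))).
  - intros x _. specialize (Hpos x). auto_derive; [exact I|].
    unfold Rsqr. simpl in Hpos. field. split; [lra|].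
    nra.
  - intros x _. specialize (Hpos x).
    apply (ex_derive_continuous (fun x => s / ((x - xi) ^ 2 + s ^ 2))).
    auto_derive. simpl in Hpos; lra.
  - unfold minus, plus, opp; simpl.
    replace ((xi - s - xi) / s) with (- (1)) by (field; lra).
    replace ((xi + s - xi) / s) with 1 by (field; lra).
    rewrite atan_opp, atan_1. field.
Qed.

(** On each side of the square of half side [s], both components of [1 / (z - c)]
    are combinations of these two real integrands. *)
Lemma RIntC_square_side (q : R -> C) (al be ga de xi s : R) : 0 < s ->
  (forall x, q x = ((al * (x - xi) + be * s) / ((x - xi) ^ 2 + s ^ 2),
                    (ga * (x - xi) + de * s) / ((x - xi) ^ 2 + s ^ 2))) ->
  RIntC q (xi - s) (xi + s) = (be * (PI / 2), de * (PI / 2)).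
Proof.
  intros Hs Hq. apply is_RIntC_unique.
  assert (Hpos : forall x, 0 < (x - xi) ^ 2 + s ^ 2)
    by (intros x; generalize (pow2_ge_0 (x - xi)); nra).
  assert (H1 := is_RInt_square_odd xi s Hs). assert (H2 := is_RInt_square_even xi s Hs).
  assert (H : forall a b, is_RInt (fun x => (a * (x - xi) + b * s) / ((x - xi) ^ 2 + s ^ 2))
     (xi - s) (xi + s) (b * (PI / 2))).
  { intros a b.
    replace (b * (PI / 2)) with (plus (scal a 0) (scal b (PI / 2)))
      by (unfold plus, scal; simpl; unfold mult; simpl; ring).
    generalize (is_RInt_plus _ _ _ _ _ _ (is_RInt_scal _ _ _ a _ H1)
      (is_RInt_scal _ _ _ b _ H2)).
    apply is_RInt_ext. intros x _. unfold plus, scal; simpl; unfold mult; simpl.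
    specialize (Hpos x). field. simpl in Hpos. lra. }
  apply (@is_RInt_fct_extend_pair R_NormedModule R_NormedModule).
  - generalize (H al be). apply is_RInt_ext. intros x _. now rewrite Hq.
  - generalize (H ga de). apply is_RInt_ext. intros x _. now rewrite Hq.
Qed.

Lemma rect_integral_square (xi eta s : R) : 0 < s ->
  rect_integral (fun z => / (z - (xi, eta)))%C (xi - s) (xi + s) (eta - s) (eta + s)
  = (2 * PI * Ci)%C.
Proof.
  intros Hs. unfold rect_integral.
  rewrite (RIntC_square_side _ 1 0 0 1 xi s Hs).
  rewrite (RIntC_square_side _ 0 1 (-1) 0 eta s Hs).
  rewrite (RIntC_square_side _ 1 0 0 (-1) xi s Hs).
  rewrite (RIntC_square_side _ 0 (-1) (-1) 0 eta s Hs).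
  apply injective_projections; simpl; field.
  all: intros t; assert (0 < (t - xi) ^ 2 + s ^ 2) by (generalize (pow2_ge_0 (t - xi)); nra);
       assert (0 < (t - eta) ^ 2 + s ^ 2) by (generalize (pow2_ge_0 (t - eta)); nra).
  all: apply injective_projections; simpl in *; field; repeat split; nra.
Qed.

(** The rectangle minus the square is cut into four rectangles (left and right of
    full height, bottom and top in the middle column), on which Goursat applies. *)
Lemma rect_integral_around_square (q : C -> C) x0 x1 y0 y1 xi eta s : 0 < s ->
  x0 <= xi - s -> xi + s <= x1 -> y0 <= eta - s -> eta + s <= y1 ->
  (forall x y, x0 <= x <= x1 -> y0 <= y <= y1 -> (x, y) <> (xi, eta) -> Cdiff q (x, y)) ->
  rect_integral q x0 x1 y0 y1
  = rect_integral q (xi - s) (xi + s) (eta - s) (eta + s).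
Proof.
  intros Hs Hx0 Hx1 Hy0 Hy1 Hq.
  assert (Hout : forall x y, x0 <= x <= x1 -> y0 <= y <= y1 ->
    x <= xi - s \/ xi + s <= x \/ y <= eta - s \/ eta + s <= y -> Cdiff q (x, y)).
  { intros x y Hx Hy H. apply Hq; auto. intros E; injection E; intros; lra. }
  rewrite (rect_integral_split_h q x0 (xi - s) x1);
    [|lra|lra|intros t Ht; split; apply Hout; lra].
  rewrite (rect_integral_split_h q (xi - s) (xi + s) x1);
    [|lra|lra|intros t Ht; split; apply Hout; lra].
  rewrite (rect_integral_split_v q (xi - s) (xi + s) y0 (eta - s) y1);
    [|lra|lra|intros t Ht; split; apply Hout; lra].
  rewrite (rect_integral_split_v q (xi - s) (xi + s) (eta - s) (eta + s) y1);
    [|lra|lra|intros t Ht; split; apply Hout; lra].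
  rewrite (goursat q x0 (xi - s)) by (try lra; intros x y Hx Hy; apply Hout; lra).
  rewrite (goursat q (xi + s) x1) by (try lra; intros x y Hx Hy; apply Hout; lra).
  rewrite (goursat q (xi - s) (xi + s) y0 (eta - s))
    by (try lra; intros x y Hx Hy; apply Hout; lra).
  rewrite (goursat q (xi - s) (xi + s) (eta + s) y1)
    by (try lra; intros x y Hx Hy; apply Hout; lra).
  ring.
Qed.

Lemma on_edges_ring xi eta s : 0 < s ->
  on_edges (fun z => z <> (xi, eta) /\ s <= Cmod (z - (xi, eta)) <= 2 * s)
    (xi - s) (xi + s) (eta - s) (eta + s).
Proof.
  intros Hs.
  assert (Hup : forall x y, Rabs (x - xi) <= s -> Rabs (y - eta) <= s ->
    Cmod ((x, y) - (xi, eta)) <= 2 * s).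
  { intros x y H1 H2.
    replace ((x, y) - (xi, eta))%C with (RtoC (x - xi) + Ci * RtoC (y - eta))%C
      by (apply injective_projections; simpl; ring).
    eapply Rle_trans; [apply Cmod_triangle|].
    rewrite Cmod_mult, Cmod_Ci, !Cmod_R. lra. }
  assert (Hlow : forall x y, s <= Rabs (x - xi) \/ s <= Rabs (y - eta) ->
    s <= Cmod ((x, y) - (xi, eta))).
  { intros x y H. eapply Rle_trans; [|apply Rmax_Cmod]. simpl.
    destruct H as [H|H]; [eapply Rle_trans; [exact H|apply Rmax_l]
      |eapply Rle_trans; [exact H|apply Rmax_r]]. }
  assert (A1 : Rabs (xi - s - xi) = s)
    by (replace (xi - s - xi) with (- s) by ring; rewrite Rabs_Ropp, Rabs_right; lra).
  assert (A2 : Rabs (xi + s - xi) = s)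
    by (replace (xi + s - xi) with s by ring; rewrite Rabs_right; lra).
  assert (A3 : Rabs (eta - s - eta) = s)
    by (replace (eta - s - eta) with (- s) by ring; rewrite Rabs_Ropp, Rabs_right; lra).
  assert (A4 : Rabs (eta + s - eta) = s)
    by (replace (eta + s - eta) with s by ring; rewrite Rabs_right; lra).
  split; intros t Ht; split; (split; [intros E; injection E; intros; lra|split]).
  all: (apply Hlow; lra) || (apply Hup; try lra; apply Rabs_le; lra).
Qed.

Lemma on_edges_and (Q Q' : C -> Prop) x0 x1 y0 y1 :
  on_edges Q x0 x1 y0 y1 -> on_edges Q' x0 x1 y0 y1 ->
  on_edges (fun z => Q z /\ Q' z) x0 x1 y0 y1.
Proof.
  intros [H1 H2] [H1' H2']; split; intros t Ht;
   [destruct (H1 t Ht), (H1' t Ht)|destruct (H2 t Ht), (H2' t Ht)]; repeat split; assumption.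
Qed.

(** After shrinking to a square of half side [s], replace [g z] by its value at the
    centre: the error on the contour, which has length [8 s], is at most
    [eps / 8 / s] by continuity. *)
Theorem cauchy_formula_rect (g : C -> C) x0 x1 y0 y1 xi eta :
  x0 < xi < x1 -> y0 < eta < y1 ->
  on_rect (fun z => Cdiff g z) x0 x1 y0 y1 ->
  rect_integral (fun z => g z * / (z - (xi, eta)))%C x0 x1 y0 y1
  = (2 * PI * Ci * g (xi, eta))%C.
Proof.
  intros Hx Hy Hg.
  set (q := fun z => (g z * / (z - (xi, eta)))%C).
  apply Ceq_minus, Cmod_eq_0, Rle_antisym; [|apply Cmod_ge_0].
  apply le_epsilon. intros eps Heps. rewrite Rplus_0_l.
  destruct (Cdiff_eps_continuous g (xi, eta)) with (eps := eps / 8) as (delta & Hdelta & Hd).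
  { apply Hg; lra. } { lra. }
  assert (Hs : exists s, 0 < s /\ s <= delta / 4 /\ s <= xi - x0 /\ s <= x1 - xi
    /\ s <= eta - y0 /\ s <= y1 - eta).
  { exists (Rmin (delta / 4) (Rmin (Rmin (xi - x0) (x1 - xi)) (Rmin (eta - y0) (y1 - eta)))).
    repeat apply conj.
    - repeat apply Rmin_pos; lra.
    - apply Rmin_l.
    - eapply Rle_trans; [apply Rmin_r|]. eapply Rle_trans; [apply Rmin_l|]. apply Rmin_l.
    - eapply Rle_trans; [apply Rmin_r|]. eapply Rle_trans; [apply Rmin_l|]. apply Rmin_r.
    - eapply Rle_trans; [apply Rmin_r|]. eapply Rle_trans; [apply Rmin_r|]. apply Rmin_l.
    - eapply Rle_trans; [apply Rmin_r|]. eapply Rle_trans; [apply Rmin_r|]. apply Rmin_r. }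
  destruct Hs as (s & Hs & Hs1 & Hs2 & Hs3 & Hs4 & Hs5).
  rewrite (rect_integral_around_square q x0 x1 y0 y1 xi eta s); try lra.
  2:{ intros x y Hx' Hy' Hne. apply Cdiff_mult; [now apply Hg|now apply Cdiff_kernel]. }
  set (c := g (xi, eta)).
  set (k := fun z => (/ (z - (xi, eta)))%C).
  assert (Hne := on_edges_ring xi eta s Hs).
  assert (Hgs : on_edges (fun z => Cdiff g z) (xi - s) (xi + s) (eta - s) (eta + s)).
  { apply on_rect_edges; try lra. intros x y Hx' Hy'. apply Hg; lra. }
  assert (Hks : on_edges (fun z => Cdiff k z) (xi - s) (xi + s) (eta - s) (eta + s)).
  { refine (on_edges_imp _ _ _ _ _ _ _ Hne). intros z [Hz _]. now apply Cdiff_kernel. }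
  assert (Hqs : on_edges (fun z => Cdiff q z) (xi - s) (xi + s) (eta - s) (eta + s)).
  { refine (on_edges_imp _ _ _ _ _ _ _ (on_edges_and _ _ _ _ _ _ Hgs Hks)).
    intros z [G K]. now apply Cdiff_mult. }
  assert (Hcs : on_edges (fun z => Cdiff (fun z => c * k z)%C z)
     (xi - s) (xi + s) (eta - s) (eta + s)).
  { refine (on_edges_imp _ _ _ _ _ _ _ Hks).
    intros z K. apply Cdiff_mult; [apply Cdiff_const|exact K]. }
  replace (rect_integral q (xi - s) (xi + s) (eta - s) (eta + s) - 2 * PI * Ci * c)%C
    with (rect_integral (fun z => q z - c * k z)%C
            (xi - s) (xi + s) (eta - s) (eta + s)).
  2:{ rewrite rect_integral_minus by (try lra; assumption).
      rewrite <- (rect_integral_square xi eta s Hs). fold k.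
      replace (rect_integral (fun z => c * k z)%C
          (xi - s) (xi + s) (eta - s) (eta + s)) with
       (c * rect_integral k (xi - s) (xi + s) (eta - s) (eta + s))%C; [ring|].
      destruct (ex_RIntC_edges k (xi - s) (xi + s) (eta - s) (eta + s))
        as (K1 & K2 & K3 & K4); try lra; [exact Hks|].
      unfold rect_integral.
      rewrite (RIntC_Cmult c _ _ _ K1), (RIntC_Cmult c _ _ _ K2),
        (RIntC_Cmult c _ _ _ K3), (RIntC_Cmult c _ _ _ K4). ring. }
  eapply Rle_trans.
  - apply rect_integral_le with (M := eps / 8 / s); try lra.
    + refine (on_edges_imp _ _ _ _ _ _ _ (on_edges_and _ _ _ _ _ _ Hqs Hcs)).
      intros z [Hz1 Hz2]. now apply Cdiff_minus.
    + refine (on_edges_imp _ _ _ _ _ _ _ Hne). intros z (Hz & Hz1 & Hz2).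
      replace (q z - c * k z)%C with ((g z - c) / (z - (xi, eta)))%C
        by (unfold q, k, Cdiv; ring).
      rewrite Cmod_div by now apply Cminus_0_neq.
      assert (Hd' : Cmod (g z - c) < eps / 8) by (apply Hd; lra).
      apply Rle_div_l; [lra|]. apply Rle_trans with (eps / 8); [lra|].
      apply Rle_trans with (eps / 8 / s * s); [apply Req_le; field; lra|].
      apply Rmult_le_compat_l; [|lra]. apply Rlt_le, Rdiv_lt_0_compat; lra.
  - apply Req_le. field. lra.
Qed.

(** * Improper integrals along horizontal lines *)

Notation minf := (Rbar_locally m_infty).
Notation pinf := (Rbar_locally p_infty).
Notation is_RIntC_line q l := (@is_RInt_gen C_R_NormedModule q minf pinf l).

Lemma filter_prod_rays (Q : R * R -> Prop) : filter_prod minf pinf Q ->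
  exists B, 0 <= B /\ forall a b, a <= - B -> B <= b -> Q (a, b).
Proof.
  intros [Q1 Q2 [M1 H1] [M2 H2] H].
  exists (Rmax (Rabs M1) (Rabs M2) + 1).
  generalize (Rmax_l (Rabs M1) (Rabs M2)) (Rmax_r (Rabs M1) (Rabs M2))
    (Rle_abs (- M1)) (Rle_abs M2) (Rabs_pos M1). rewrite Rabs_Ropp.
  intros. split; [lra|]. intros a b Ha Hb. apply H; [apply H1|apply H2]; lra.
Qed.

Lemma filter_prod_rays_intro (Q : R * R -> Prop) B :
  (forall a b, a < - B -> B < b -> Q (a, b)) -> filter_prod minf pinf Q.
Proof.
  intros H. exists (fun a => a < - B) (fun b => B < b).
  - now exists (- B). - now exists B. - exact H.
Qed.

(** Integrability on segments is kept separately: the improper integral alone only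
    gives it for segments with distant end points. *)
Definition line_majorant (m : R -> R) (I : R) : Prop :=
  (forall x, 0 <= m x) /\ (forall a b, ex_RInt m a b) /\ is_RInt_gen m minf pinf I.

Lemma line_majorant_scal m I A : 0 <= A -> line_majorant m I -> line_majorant (fun x => A * m x) (A * I).
Proof.
  intros HA (H1 & H2 & H3). repeat split.
  - intros x. now apply Rmult_le_pos.
  - intros a b. exact (ex_RInt_scal m a b A (H2 a b)).
  - exact (is_RInt_gen_scal m A I H3).
Qed.

Lemma line_majorant_rays m I : line_majorant m I -> forall eps, 0 < eps ->
  exists B, 0 <= B /\ forall a b, a <= - B -> B <= b -> Rabs (RInt m a b - I) < eps.
Proof.
  intros (H1 & H2 & H3) eps Heps.
  specialize (H3 _ (locally_ball I (mkposreal eps Heps))).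
  destruct (filter_prod_rays _ H3) as (B & HB & H).
  exists B; split; auto. intros a b Ha Hb.
  destruct (H a b Ha Hb) as (y & Hy & Hy'). simpl in Hy.
  rewrite (is_RInt_unique _ _ _ _ Hy). exact Hy'.
Qed.

Lemma Cmod_RIntC_dominated (q : R -> C) (m : R -> R) a b : a <= b ->
  ex_RIntC q a b -> ex_RInt m a b -> (forall x, Cmod (q x) <= m x) ->
  Cmod (RIntC q a b) <= RInt m a b.
Proof.
  intros Hab Hq Hm H. rewrite Cmod_norm.
  assert (H' : forall x, a <= x <= b -> @norm R_AbsRing C_R_NormedModule (q x) <= m x).
  { intros x _. change (@norm R_AbsRing C_R_NormedModule (q x)) with
      (@norm R_AbsRing (prod_NormedModule R_AbsRing R_NormedModule R_NormedModule) (q x)).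
    rewrite <- Cmod_norm. apply H. }
  exact (@norm_RInt_le C_R_NormedModule q m a b _ _ Hab H' (RIntC_correct _ _ _ Hq)
    (RInt_correct m a b Hm)).
Qed.

(** Dominated improper integrals converge, by Cauchy's criterion. *)
Lemma ex_RIntC_line (q : R -> C) m I : line_majorant m I ->
  (forall a b, ex_RIntC q a b) -> (forall x, Cmod (q x) <= m x) ->
  @ex_RInt_gen C_R_NormedModule q minf pinf.
Proof.
  intros Hm Hq Hqm.
  apply (@filterlimi_locally_cauchy (R * R) C_R_CompleteNormedModule
    (filter_prod minf pinf) _ (fun ab => @is_RInt C_R_NormedModule q (fst ab) (snd ab))).
  - apply filter_forall. intros [a b]; split.
    + exists (RIntC q a b). apply RIntC_correct, Hq.
    + intros y1 y2 H1 H2. apply is_RIntC_unique in H1, H2. simpl in H1, H2. congruence.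
  - intros eps.
    destruct (line_majorant_rays m I Hm (eps / 4)) as (B & HB & HI).
    { generalize (cond_pos eps); lra. }
    destruct Hm as (Hm0 & Hm1 & _).
    exists (fun ab => fst ab < - B /\ B < snd ab); split.
    { now apply filter_prod_rays_intro with B. }
    (* each tail of q is controlled by the difference of two integrals of m *)
    assert (Hle : forall a b, a <= b -> Cmod (RIntC q a b) <= RInt m a b).
    { intros a b Hab. apply Cmod_RIntC_dominated; auto. }
    assert (Hch : forall a b c, RInt m a b + RInt m b c = RInt m a c).
    { intros a b c. exact (RInt_Chasles m a b c (Hm1 a b) (Hm1 b c)). }
    assert (HtL : forall a a', a <= - B -> a' <= - B -> Cmod (RIntC q a a') < eps / 2).
    { assert (W : forall a a', a <= a' -> a' <= - B -> Cmod (RIntC q a a') < eps / 2).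
      { intros a a' Haa Ha'. eapply Rle_lt_trans; [now apply Hle|].
        generalize (HI a B) (HI a' B) (Hch a a' B). intros I1 I2.
        assert (Rabs (RInt m a B - I) < eps / 4) by (apply I1; lra).
        assert (Rabs (RInt m a' B - I) < eps / 4) by (apply I2; lra).
        apply Rabs_def2 in H, H0. lra. }
      intros a a' Ha Ha'. destruct (Rle_dec a a') as [H|H]; [now apply W|].
      assert (E := @opp_RInt_swap C_R_CompleteNormedModule q a' a (Hq a' a)).
      change (@opp C_R_CompleteNormedModule (RIntC q a' a)) with (- RIntC q a' a)%C in E.
      rewrite <- E, Cmod_opp. apply W; lra. }
    assert (HtR : forall b b', B <= b -> B <= b' -> Cmod (RIntC q b b') < eps / 2).
    { assert (W : forall b b', b <= b' -> B <= b -> Cmod (RIntC q b b') < eps / 2).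
      { intros b b' Hbb Hb. eapply Rle_lt_trans; [now apply Hle|].
        generalize (HI (- B) b) (HI (- B) b') (Hch (- B) b b'). intros I1 I2.
        assert (Rabs (RInt m (- B) b - I) < eps / 4) by (apply I1; lra).
        assert (Rabs (RInt m (- B) b' - I) < eps / 4) by (apply I2; lra).
        apply Rabs_def2 in H, H0. lra. }
      intros b b' Hb Hb'. destruct (Rle_dec b b') as [H|H]; [now apply W|].
      assert (E := @opp_RInt_swap C_R_CompleteNormedModule q b' b (Hq b' b)).
      change (@opp C_R_CompleteNormedModule (RIntC q b' b)) with (- RIntC q b' b)%C in E.
      rewrite <- E, Cmod_opp. apply W; lra. }
    intros [a b] [a' b'] [Ha Hb] [Ha' Hb'] u v Hu Hv. simpl in *.
    apply is_RIntC_unique in Hu, Hv. subst u v.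
    apply (C_NormedModule_mixin_compat1 (RIntC q a b) (RIntC q a' b')).
    change (Cmod (RIntC q a' b' - RIntC q a b)%C < eps).
    rewrite <- (RIntC_Chasles q a' a b') by auto.
    rewrite <- (RIntC_Chasles q a b b') by auto.
    replace (RIntC q a' a + (RIntC q a b + RIntC q b b') - RIntC q a b)%C
      with (RIntC q a' a + RIntC q b b')%C by ring.
    eapply Rle_lt_trans; [apply Cmod_triangle|].
    assert (Cmod (RIntC q a' a) < eps / 2) by (apply HtL; lra).
    assert (Cmod (RIntC q b b') < eps / 2) by (apply HtR; lra). lra.
Qed.

(** Improper integrals are computed below through symmetric truncations, because
    these are the horizontal sides of the rectangles [[-X, X] x [a, c]]. *)
Definition Clim_infty (u : R -> C) (l : C) : Prop :=
  forall eps, 0 < eps -> exists B, 0 <= B /\ forall x, B <= x -> Cmod (u x - l) <= eps.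

Lemma Clim_infty_unique u l l' : Clim_infty u l -> Clim_infty u l' -> l = l'.
Proof.
  intros H H'. apply Ceq_minus, Cmod_eq_0, Rle_antisym; [|apply Cmod_ge_0].
  apply le_epsilon. intros eps Heps.
  destruct (H (eps / 2)) as (B & _ & HB); [lra|].
  destruct (H' (eps / 2)) as (B' & _ & HB'); [lra|].
  specialize (HB (Rmax B B') (Rmax_l _ _)). specialize (HB' (Rmax B B') (Rmax_r _ _)).
  replace (l - l')%C with ((u (Rmax B B') - l') - (u (Rmax B B') - l))%C by ring.
  generalize (Cmod_minus_triangle (u (Rmax B B') - l') (u (Rmax B B') - l)). lra.
Qed.

Lemma Clim_infty_minus u v l l' :
  Clim_infty u l -> Clim_infty v l' -> Clim_infty (fun x => u x - v x)%C (l - l')%C.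
Proof.
  intros H H' eps Heps.
  destruct (H (eps / 2)) as (B & HB0 & HB); [lra|].
  destruct (H' (eps / 2)) as (B' & HB0' & HB'); [lra|].
  exists (Rmax B B'). split; [eapply Rle_trans; [apply HB0|apply Rmax_l]|].
  intros x Hx.
  replace (u x - v x - (l - l'))%C with ((u x - l) - (v x - l'))%C by ring.
  generalize (Cmod_minus_triangle (u x - l) (v x - l')).
  specialize (HB x (Rle_trans _ _ _ (Rmax_l _ _) Hx)).
  specialize (HB' x (Rle_trans _ _ _ (Rmax_r _ _) Hx)). lra.
Qed.

Lemma Clim_infty_Cmult c u l : Clim_infty u l -> Clim_infty (fun x => c * u x)%C (c * l)%C.
Proof.
  intros H eps Heps.
  destruct (H (eps / (Cmod c + 1))) as (B & HB0 & HB).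
  { apply Rdiv_lt_0_compat; [easy|]. generalize (Cmod_ge_0 c); lra. }
  exists B; split; auto. intros x Hx. specialize (HB x Hx).
  replace (c * u x - c * l)%C with (c * (u x - l))%C by ring.
  rewrite Cmod_mult. generalize (Cmod_ge_0 c) (Cmod_ge_0 (u x - l)); intros Hc Hu.
  apply Rle_trans with ((Cmod c + 1) * (eps / (Cmod c + 1))).
  - apply Rmult_le_compat; lra.
  - apply Req_le. field. lra.
Qed.

Definition line_dominated (m : R -> R) (y : R) (q : C -> C) : Prop :=
  forall x, Cdiff q (x, y) /\ Cmod (q (x, y)) <= m x.

Lemma line_dominated_ex_RIntC m y q : line_dominated m y q ->
  forall a b, ex_RIntC (fun x => q (x, y)) a b.
Proof.
  intros H a b. apply (@ex_RInt_continuous C_R_CompleteNormedModule).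
  intros x _. apply (Cdiff_continuous_h q), H.
Qed.

Lemma line_integral_correct m I y q : line_majorant m I -> line_dominated m y q ->
  is_RIntC_line (fun x => q (x, y)) (line_integral y q).
Proof.
  intros Hm Hq.
  apply (@RInt_gen_correct C_R_CompleteNormedModule minf pinf _ _ (fun x => q (x, y))).
  apply ex_RIntC_line with m I; auto.
  - now apply line_dominated_ex_RIntC with m.
  - intros x. apply Hq.
Qed.

Lemma line_integral_lim m I y q : line_majorant m I -> line_dominated m y q ->
  Clim_infty (fun X => RIntC (fun x => q (x, y)) (- X) X) (line_integral y q).
Proof.
  intros Hm Hq eps Heps.
  assert (H := line_integral_correct _ _ _ _ Hm Hq).
  assert (Hs : 0 < eps / sqrt 2) by (apply Rdiv_lt_0_compat; [lra|apply Rlt_sqrt2_0]).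
  specialize (H _ (locally_ball (line_integral y q : C_R_NormedModule) (mkposreal _ Hs))).
  destruct (filter_prod_rays _ H) as (B & HB & H').
  exists B; split; auto. intros X HX.
  destruct (H' (- X) X) as (l & Hl & Hl'); [lra|lra|].
  apply is_RIntC_unique in Hl. simpl in Hl. rewrite Hl.
  apply (C_NormedModule_mixin_compat2 (line_integral y q) l) in Hl'. simpl in Hl'.
  apply Rlt_le. replace eps with (sqrt 2 * (eps / sqrt 2)); [exact Hl'|].
  field. apply Rgt_not_eq, Rlt_sqrt2_0.
Qed.

Lemma Cmod_line_integral_le m I y q : line_majorant m I -> line_dominated m y q ->
  Cmod (line_integral y q) <= I.
Proof.
  intros Hm Hq. rewrite Cmod_norm.
  apply (@RInt_gen_norm C_R_CompleteNormedModule minf pinf _ _ (fun x => q (x, y)) m).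
  - apply filter_prod_rays_intro with 0. intros a b Ha Hb; simpl; lra.
  - apply filter_forall. intros ab x _. 
    change (@norm R_AbsRing (prod_NormedModule R_AbsRing R_NormedModule R_NormedModule) (q (x, y)) <= m x).
    rewrite <- Cmod_norm. apply Hq.
  - now apply line_integral_correct with m I.
  - apply Hm.
Qed.

Lemma line_integral_minus m I m' I' y p q : line_majorant m I -> line_majorant m' I' ->
  line_dominated m y p -> line_dominated m' y q ->
  line_integral y (fun z => p z - q z)%C = (line_integral y p - line_integral y q)%C.
Proof.
  intros Hm Hm' Hp Hq.
  assert (H := @is_RInt_gen_minus C_R_NormedModule minf pinf _ _
    (fun x => p (x, y)) (fun x => q (x, y)) _ _
    (line_integral_correct _ _ _ _ Hm Hp) (line_integral_correct _ _ _ _ Hm' Hq)).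
  exact (@is_RInt_gen_unique C_R_CompleteNormedModule minf pinf _ _
    (fun x => p (x, y) - q (x, y))%C _ H).
Qed.

Lemma line_integral_ext m I y p q : line_majorant m I -> line_dominated m y p ->
  (forall x, p (x, y) = q (x, y)) -> line_integral y p = line_integral y q.
Proof.
  intros Hm Hp H. symmetry.
  assert (H' := line_integral_correct _ _ _ _ Hm Hp).
  apply (@is_RInt_gen_unique C_R_CompleteNormedModule minf pinf _ _ (fun x => q (x, y))).
  refine (@is_RInt_gen_ext C_R_NormedModule minf pinf _ _ _ _ _ _ H').
  apply filter_forall. intros ab x _. apply H.
Qed.

Lemma line_dominated_Cmult m y c q : line_dominated m y q ->
  line_dominated (fun x => Cmod c * m x) y (fun z => c * q z)%C.
Proof.
  intros H x; split.
  - apply Cdiff_mult; [apply Cdiff_const|apply H].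
  - rewrite Cmod_mult. apply Rmult_le_compat_l; [apply Cmod_ge_0|apply H].
Qed.

(** By uniqueness of the limit of the truncated integrals. *)
Lemma line_integral_Cmult m I y c q : line_majorant m I -> line_dominated m y q ->
  line_integral y (fun z => c * q z)%C = (c * line_integral y q)%C.
Proof.
  intros Hm Hq.
  apply Clim_infty_unique with (fun X => RIntC (fun x => c * q (x, y))%C (- X) X).
  - apply (line_integral_lim _ _ y (fun z => c * q z)%C
      (line_majorant_scal _ _ (Cmod c) (Cmod_ge_0 c) Hm)).
    now apply line_dominated_Cmult.
  - intros eps Heps.
    destruct (Clim_infty_Cmult c _ _ (line_integral_lim _ _ _ _ Hm Hq) eps Heps)
     as (B & HB & H).
    exists B; split; auto. intros X HX. rewrite RIntC_Cmult.
    + now apply H.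
    + now apply line_dominated_ex_RIntC with m.
Qed.

(** * Cauchy's theorem and formula on infinite strips *)

Definition vanishing (m : R -> R) : Prop :=
  forall eps, 0 < eps -> exists B, 0 <= B /\ forall x, B <= Rabs x -> m x <= eps.

(** The vertical sides tend to 0 because [m] vanishes at infinity.  The function
    [q] is only controlled on the two lines and for large [|Re z|], so that this
    applies both to [g] and to [g / (z - w)] with [w] inside the strip. *)
Lemma strip_contour (m : R -> R) ma Ia mc Ic a c q v X1 : a < c ->
  vanishing m ->
  line_majorant ma Ia -> line_dominated ma a q ->
  line_majorant mc Ic -> line_dominated mc c q ->
  (forall x y, X1 <= Rabs x -> a <= y <= c -> Cdiff q (x, y) /\ Cmod (q (x, y)) <= m x) ->
  (forall X, 0 < X -> X1 <= X -> rect_integral q (- X) X a c = v) ->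
  (line_integral a q - line_integral c q)%C = v.
Proof.
  intros Hac Hm Hma Ha Hmc Hc Hq Hv.
  assert (La := line_integral_lim _ _ _ _ Hma Ha).
  assert (Lc := line_integral_lim _ _ _ _ Hmc Hc).
  refine (Clim_infty_unique _ _ _ (Clim_infty_minus _ _ _ _ La Lc) _).
  intros eps Heps.
  destruct (Hm (eps / (2 * (c - a)))) as (B & HB & HmB); [apply Rdiv_lt_0_compat; lra|].
  exists (Rmax 1 (Rmax B X1)); split.
  { apply Rle_trans with 1; [lra|apply Rmax_l]. }
  intros X HX.
  assert (HX1 : 1 <= X) by (eapply Rle_trans; [apply Rmax_l|apply HX]).
  assert (HXB : B <= X).
  { eapply Rle_trans; [|apply HX]. eapply Rle_trans; [|apply Rmax_r]. apply Rmax_l. }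
  assert (HXX : X1 <= X).
  { eapply Rle_trans; [|apply HX]. eapply Rle_trans; [|apply Rmax_r]. apply Rmax_r. }
  rewrite <- (Hv X) by lra. unfold rect_integral.
  match goal with |- Cmod ?t <= _ => replace t with
    (Ci * RIntC (fun y => q ((- X)%R, y)) a c - Ci * RIntC (fun y => q (X, y)) a c)%C by ring end.
  assert (W : forall x, Rabs x = X -> Cmod (RIntC (fun y => q (x, y)) a c) <= eps / 2).
  { intros x Hx.
    eapply Rle_trans; [apply Cmod_RIntC_le with (M := eps / (2 * (c - a)))|].
    - lra.
    - apply (ex_RIntC_v q); [lra|]. intros y Hy. apply Hq; lra.
    - intros y Hy. eapply Rle_trans; [apply Hq; lra|]. apply HmB. lra.
    - apply Req_le. field. lra. }
  eapply Rle_trans; [apply Cmod_minus_triangle|].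
  rewrite !Cmod_mult, Cmod_Ci.
  generalize (W (- X) ltac:(rewrite Rabs_Ropp, Rabs_right; lra))
    (W X ltac:(rewrite Rabs_right; lra)). lra.
Qed.

Definition strip_dominated (m : R -> R) (a c : R) (g : C -> C) : Prop :=
  forall y, a <= y <= c -> line_dominated m y g.

Theorem cauchy_strip m I a c g : a < c -> line_majorant m I -> vanishing m ->
  strip_dominated m a c g -> line_integral a g = line_integral c g.
Proof.
  intros Hac Hm Hv Hg. apply Ceq_minus.
  apply (strip_contour m m I m I a c g (RtoC 0) 0); auto.
  - apply Hg; lra.
  - apply Hg; lra.
  - intros x y _ Hy. now apply Hg.
  - intros X HX _. apply goursat; try lra. intros x y _ Hy. now apply Hg.
Qed.

Lemma vanishing_scal m A : 0 <= A -> vanishing m -> vanishing (fun x => A * m x).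
Proof.
  intros HA H eps Heps.
  destruct (H (eps / (A + 1))) as (B & HB & HB'); [apply Rdiv_lt_0_compat; lra|].
  exists B; split; auto. intros x Hx. specialize (HB' x Hx).
  apply Rle_trans with (A * (eps / (A + 1))); [now apply Rmult_le_compat_l|].
  apply Rle_trans with ((A + 1) * (eps / (A + 1))); [|apply Req_le; field; lra].
  apply Rmult_le_compat_r; [|lra]. apply Rlt_le, Rdiv_lt_0_compat; lra.
Qed.

Lemma line_dominated_mult m A y f p : 0 <= A -> line_dominated m y f ->
  (forall x, Cdiff p (x, y) /\ Cmod (p (x, y)) <= A) ->
  line_dominated (fun x => A * m x) y (fun z => f z * p z)%C.
Proof.
  intros HA Hf Hp x. destruct (Hf x) as [F1 F2], (Hp x) as [P1 P2]. split.
  - now apply Cdiff_mult.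
  - rewrite Cmod_mult, Rmult_comm. apply Rmult_le_compat; auto using Cmod_ge_0.
Qed.

Lemma Cmod_ge_dIm (z w : C) : Rabs (Im z - Im w) <= Cmod (z - w).
Proof. eapply Rle_trans; [|apply Rmax_Cmod]. apply Rmax_r. Qed.

Lemma Cmod_ge_dRe (z w : C) : Rabs (Re z - Re w) <= Cmod (z - w).
Proof. eapply Rle_trans; [|apply Rmax_Cmod]. apply Rmax_l. Qed.

Lemma kernel_bound (z w : C) d : 0 < d -> d <= Cmod (z - w) ->
  Cdiff (fun z => / (z - w))%C z /\ Cmod (/ (z - w)) <= / d.
Proof.
  intros Hd H.
  assert (Hne : (z - w)%C <> 0) by (apply Cmod_gt_0; lra).
  split.
  - apply Cdiff_kernel. intros E. exact (Hne (proj1 (Ceq_minus z w) E)).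
  - rewrite Cmod_inv by easy. now apply Rinv_le_contravar.
Qed.

Lemma line_dominated_kernel m y f w d : 0 < d -> d <= Rabs (y - Im w) ->
  line_dominated m y f ->
  line_dominated (fun x => / d * m x) y (fun z => f z * / (z - w))%C.
Proof.
  intros Hd H Hf. apply line_dominated_mult; auto.
  - now apply Rlt_le, Rinv_0_lt_compat.
  - intros x. apply kernel_bound; auto.
    eapply Rle_trans; [apply H|]. apply (Cmod_ge_dIm (x, y) w).
Qed.

(** The constant [|xi| + 1] keeps [z] at distance at least 1 from [w]. *)
Theorem cauchy_formula_strip m I a c g w : a < Im w < c -> line_majorant m I -> vanishing m ->
  strip_dominated m a c g ->
  (line_integral a (fun z => g z * / (z - w)) - line_integral c (fun z => g z * / (z - w)))%C
  = (2 * PI * Ci * g w)%C.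
Proof.
  intros Hw Hm Hv Hg. destruct w as [xi eta]. cbn [Im snd] in Hw.
  apply (strip_contour m (fun x => / (eta - a) * m x) (/ (eta - a) * I)
     (fun x => / (c - eta) * m x) (/ (c - eta) * I) a c
     (fun z => g z * / (z - (xi, eta)))%C _ (Rabs xi + 1)); try lra; auto.
  - apply line_majorant_scal; auto. apply Rlt_le, Rinv_0_lt_compat; lra.
  - apply line_dominated_kernel; [lra| |apply Hg; lra].
    cbn [Im snd]. rewrite Rabs_left; lra.
  - apply line_majorant_scal; auto. apply Rlt_le, Rinv_0_lt_compat; lra.
  - apply line_dominated_kernel; [lra| |apply Hg; lra].
    cbn [Im snd]. rewrite Rabs_right; lra.
  - intros x y Hx Hy. destruct (Hg y Hy x) as [G1 G2].
    destruct (kernel_bound (x, y) (xi, eta) 1) as [K1 K2]; [lra| |].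
    + eapply Rle_trans; [|apply (Cmod_ge_dRe (x, y) (xi, eta))]. simpl.
      generalize (Rabs_triang_inv x xi). lra.
    + split; [now apply Cdiff_mult|].
      rewrite Cmod_mult, <- (Rmult_1_r (m x)). rewrite Rinv_1 in K2.
      apply Rmult_le_compat; auto using Cmod_ge_0.
  - intros X HX HX1. apply cauchy_formula_rect; try lra.
    + generalize (Rle_abs xi) (Rle_abs (- xi)). rewrite Rabs_Ropp. lra.
    + intros x y _ Hy. now apply Hg.
Qed.

(** * The majorant given by two weights *)

Lemma ex_RInt_half_line (m0 : R -> R) l :
  is_RInt_gen m0 (at_point 0) pinf l -> forall t, 0 <= t -> ex_RInt m0 0 t.
Proof.
  intros H t Ht.
  destruct (H _ (locally_ball l (mkposreal 1 Rlt_0_1))) as [Q1 Q2 HQ1 [B HB] HQ].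
  destruct (HQ 0 (Rmax B t + 1) HQ1) as (y & Hy & _).
  { apply HB. generalize (Rmax_l B t); lra. }
  apply (ex_RInt_Chasles_1 m0 0 t (Rmax B t + 1)).
  - generalize (Rmax_r B t); lra.
  - now exists y.
Qed.

Lemma half_line_lim (m0 : R -> R) l : is_RInt_gen m0 (at_point 0) pinf l ->
  forall eps, 0 < eps -> exists B, 0 <= B /\ forall t, B < t -> Rabs (RInt m0 0 t - l) < eps.
Proof.
  intros H eps Heps.
  destruct (H _ (locally_ball l (mkposreal eps Heps))) as [Q1 Q2 HQ1 [B HB] HQ].
  exists (Rmax 0 B); split; [apply Rmax_l|]. intros t Ht.
  destruct (HQ 0 t HQ1) as (y & Hy & Hy').
  { apply HB. generalize (Rmax_r 0 B); lra. }
  simpl in Hy. rewrite (is_RInt_unique _ _ _ _ Hy). exact Hy'.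
Qed.

(** An even function is integrable on the line as soon as it is on the half line;
    the integral is twice as large. *)
Lemma line_majorant_even (m0 : R -> R) : (forall t, 0 <= m0 t) -> int_0_infty_finite m0 ->
  exists I, line_majorant (fun x => m0 (Rabs x)) I.
Proof.
  intros Hpos [l Hl]. exists (l + l). set (m := fun x => m0 (Rabs x)).
  assert (HR : forall t, 0 <= t -> is_RInt m 0 t (RInt m0 0 t)).
  { intros t Ht. apply (is_RInt_ext m0).
    - intros x. rewrite Rmin_left by easy. intros Hx. unfold m. rewrite Rabs_right; lra.
    - apply (RInt_correct m0 0 t). now apply ex_RInt_half_line with l. }
  assert (HL : forall t, 0 <= t -> is_RInt m (- t) 0 (RInt m0 0 t)).
  { intros t Ht. assert (H := HR t Ht).
    replace t with (- - t) in H at 1 by ring. rewrite <- Ropp_0 in H at 1.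
    apply is_RInt_comp_opp, is_RInt_swap in H.
    rewrite <- (Ropp_involutive (RInt m0 0 t)).
    generalize (is_RInt_opp _ _ _ _ H). apply is_RInt_ext.
    intros x _. unfold opp; simpl. unfold m. rewrite Rabs_Ropp. ring. }
  assert (Hsum : forall s t, 0 <= s -> 0 <= t ->
    is_RInt m (- s) t (RInt m0 0 s + RInt m0 0 t)).
  { intros s t Hs Ht. exact (is_RInt_Chasles m _ _ _ _ _ (HL s Hs) (HR t Ht)). }
  repeat split.
  - intros x. apply Hpos.
  - intros a b. set (B := Rabs a + Rabs b).
    generalize (Rabs_pos a) (Rabs_pos b); intros.
    apply (ex_RInt_inside m a b 0 B).
    + exists (RInt m0 0 B + RInt m0 0 B). unfold Rminus. rewrite !Rplus_0_l.
      apply Hsum; unfold B; lra.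
    + rewrite Rminus_0_r. unfold B; lra.
    + rewrite Rminus_0_r. unfold B; lra.
  - intros Q [eps HQ].
    destruct (half_line_lim m0 l Hl (eps / 2)) as (B & HB & HI).
    { generalize (cond_pos eps); lra. }
    apply filter_prod_rays_intro with B. intros a b Ha Hb.
    exists (RInt m0 0 (- a) + RInt m0 0 b). split.
    + simpl. rewrite <- (Ropp_involutive a) at 1. apply Hsum; lra.
    + apply HQ. unfold ball; simpl; unfold AbsRing_ball, abs, minus, plus, opp; simpl.
      generalize (HI (- a) ltac:(lra)) (HI b Hb). intros H1 H2.
      apply Rabs_def2 in H1, H2. apply Rabs_def1; lra.
Qed.

Lemma vanishing_even (u v : R -> R) : is_lim (fun t => u t - v t) p_infty p_infty ->
  vanishing (fun x => exp (v (Rabs x) - u (Rabs x))).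
Proof.
  intros H eps Heps.
  assert (H' : Rbar_locally p_infty (fun t => - ln eps < u t - v t)).
  { apply (H (fun y => - ln eps < y)). now exists (- ln eps). }
  destruct H' as [B HB]. exists (Rmax 0 B + 1); split.
  { generalize (Rmax_l 0 B); lra. }
  intros x Hx. rewrite <- (exp_ln eps) by easy.
  specialize (HB (Rabs x)). generalize (Rmax_r 0 B); intros.
  apply Rlt_le, exp_increasing. lra.
Qed.

(** * Test functions *)

(** Partial sums of [1 / (z - z0) = sum_n (z0 - z1)^n / (z - z1)^(n+1)]; each is
    analytic away from [z1], whereas the sum has its pole at [z0]. *)
Fixpoint geom (z0 z1 : C) (n : nat) (z : C) : C :=
  match n with
  | O => 0
  | S n => / (z - z1) * (1 + (z0 - z1) * geom z0 z1 n z)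
  end%C.

Lemma Cdiff_geom z0 z1 n z : z <> z1 -> Cdiff (geom z0 z1 n) z.
Proof.
  intros Hz. induction n as [|n IH]; [apply Cdiff_const|].
  apply (Cdiff_mult (fun z => / (z - z1))%C (fun z => 1 + (z0 - z1) * geom z0 z1 n z)%C).
  - now apply Cdiff_kernel.
  - apply Cdiff_plus; [apply Cdiff_const|].
    apply Cdiff_mult; [apply Cdiff_const|exact IH].
Qed.

Lemma Cmod_geom_bounded z0 z1 n d : 0 < d ->
  exists B, 0 <= B /\ forall z, d <= Cmod (z - z1) -> Cmod (geom z0 z1 n z) <= B.
Proof.
  intros Hd. induction n as [|n (B & HB & IH)].
  - exists 0; split; [lra|]. intros z _. simpl. rewrite Cmod_0; lra.
  - assert (Hi := Rinv_0_lt_compat d Hd).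
    assert (H0 : 0 <= Cmod (z0 - z1) * B) by (apply Rmult_le_pos; [apply Cmod_ge_0|easy]).
    exists (/ d * (1 + Cmod (z0 - z1) * B)). split.
    + apply Rmult_le_pos; lra.
    + intros z Hz. cbn [geom]. rewrite Cmod_mult.
      apply Rmult_le_compat; try apply Cmod_ge_0.
      * now apply kernel_bound.
      * eapply Rle_trans; [apply Cmod_triangle|]. rewrite Cmod_1, Cmod_mult.
        apply Rplus_le_compat_l, Rmult_le_compat_l; [apply Cmod_ge_0|auto].
Qed.

(** The error [1 / (z - z0) - geom z0 z1 n z] is multiplied by
    [(z0 - z1) / (z - z1)] at each step. *)
Lemma geom_remainder z0 z1 z rho : z <> z0 -> z <> z1 -> 0 <= rho ->
  Cmod (z0 - z1) <= rho * Cmod (z - z1) ->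
  forall n, Cmod (/ (z - z0) - geom z0 z1 n z) <= rho ^ n * Cmod (/ (z - z0)).
Proof.
  intros Hz0 Hz1 Hrho Hq. induction n as [|n IH].
  - simpl. unfold Cminus. rewrite Copp_0, Cplus_0_r. lra.
  - apply Cminus_0_neq in Hz0, Hz1.
    assert (Hm : 0 < Cmod (z - z1)) by now apply Cmod_gt_0.
    cbn [geom pow].
    replace (/ (z - z0) - / (z - z1) * (1 + (z0 - z1) * geom z0 z1 n z))%C
      with ((z0 - z1) / (z - z1) * (/ (z - z0) - geom z0 z1 n z))%C
      by (field; split; auto).
    rewrite Cmod_mult, Rmult_assoc. apply Rmult_le_compat; try apply Cmod_ge_0; auto.
    rewrite Cmod_div by easy. now apply Rle_div_l.
Qed.

(** * The Cauchy integral over the boundary of a strip *)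

Definition boundary_dominated (m : R -> R) (k : R) (q : C -> C) : Prop :=
  line_dominated m (- k) q /\ line_dominated m k q.

Lemma Cmod_boundary_integral_le m I k q : line_majorant m I -> boundary_dominated m k q ->
  Cmod (boundary_integral k q) <= 2 * I.
Proof.
  intros Hm [H1 H2]. unfold boundary_integral.
  generalize (Cmod_line_integral_le _ _ _ _ Hm H1) (Cmod_line_integral_le _ _ _ _ Hm H2)
    (Cmod_minus_triangle (line_integral (- k) q) (line_integral k q)). lra.
Qed.

Lemma boundary_integral_minus m I m' I' k p q : line_majorant m I -> line_majorant m' I' ->
  boundary_dominated m k p -> boundary_dominated m' k q ->
  boundary_integral k (fun z => p z - q z)%C
  = (boundary_integral k p - boundary_integral k q)%C.
Proof.
  intros Hm Hm' [P1 P2] [Q1 Q2]. unfold boundary_integral.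
  rewrite (line_integral_minus m I m' I' (- k) p q) by assumption.
  rewrite (line_integral_minus m I m' I' k p q) by assumption. ring.
Qed.

Lemma boundary_integral_ext m I k p q : line_majorant m I -> boundary_dominated m k p ->
  (forall z, Rabs (Im z) = Rabs k -> p z = q z) ->
  boundary_integral k p = boundary_integral k q.
Proof.
  intros Hm [P1 P2] H. unfold boundary_integral.
  rewrite (line_integral_ext m I (- k) p q Hm P1) by
    (intros x; apply H; simpl; apply Rabs_Ropp).
  now rewrite (line_integral_ext m I k p q Hm P2) by (intros x; now apply H).
Qed.

Lemma boundary_dominated_mult m A k f p : 0 <= A -> boundary_dominated m k f ->
  (forall z, Rabs (Im z) = Rabs k -> Cdiff p z /\ Cmod (p z) <= A) ->
  boundary_dominated (fun x => A * m x) k (fun z => f z * p z)%C.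
Proof.
  intros HA [F1 F2] Hp.
  split; apply line_dominated_mult; auto; intros x; apply Hp; simpl; auto using Rabs_Ropp.
Qed.

Lemma Rabs_minus_ge y v : Rabs (Rabs v - Rabs y) <= Rabs (y - v).
Proof. rewrite (Rabs_minus_sym y v). apply Rabs_triang_inv2. Qed.

Lemma Cmod_ge_dAbsIm (z w : C) : Rabs (Rabs (Im w) - Rabs (Im z)) <= Cmod (z - w).
Proof. eapply Rle_trans; [apply Rabs_minus_ge|apply Cmod_ge_dIm]. Qed.

Section Continuation.
Variables (b k h r : R) (f : C -> C) (m : R -> R) (I : R).
Hypotheses (Hb : 0 < b) (Hbk : b < k) (Hkh : k < h) (Hhr : h < r).
Hypotheses (Hm : line_majorant m I) (Hvan : vanishing m).
Hypothesis Hf : forall y, b < Rabs y < r -> line_dominated m y f.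

Lemma boundary_dominated_f c : b < c < r -> boundary_dominated m c f.
Proof.
  intros Hc; split; apply Hf; [rewrite Rabs_Ropp|]; rewrite Rabs_right; lra.
Qed.

Lemma boundary_dominated_kernel c w d : b < c < r -> 0 < d ->
  d <= Rabs (Rabs (Im w) - c) ->
  boundary_dominated (fun x => / d * m x) c (fun z => f z * / (z - w))%C.
Proof.
  intros Hc Hd Hdw. apply boundary_dominated_mult.
  - now apply Rlt_le, Rinv_0_lt_compat.
  - now apply boundary_dominated_f.
  - intros z Hz. apply kernel_bound; auto.
    rewrite (Rabs_right c) in Hz by lra.
    eapply Rle_trans; [apply Hdw|]. rewrite <- Hz. apply Cmod_ge_dAbsIm.
Qed.

(** Cauchy's theorem on the strip between the levels [k0] and [k] and on its mirror
    image. *)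
Lemma boundary_integral_shift k0 A p : b < k0 -> k0 < k -> 0 <= A ->
  (forall z, k0 <= Rabs (Im z) <= k -> Cdiff p z /\ Cmod (p z) <= A) ->
  boundary_integral k0 (fun z => f z * p z)%C = boundary_integral k (fun z => f z * p z)%C.
Proof.
  intros Hk0 Hk0k HA Hp. unfold boundary_integral.
  assert (Hd : forall y, k0 <= Rabs y <= k ->
    line_dominated (fun x => A * m x) y (fun z => f z * p z)%C).
  { intros y Hy. apply line_dominated_mult; auto. apply Hf; lra. }
  assert (HmA := line_majorant_scal m I A HA Hm). assert (HvA := vanishing_scal m A HA Hvan).
  rewrite (cauchy_strip _ _ k0 k _ Hk0k HmA HvA).
  2:{ intros y Hy. apply Hd. rewrite Rabs_right; lra. }
  rewrite <- (cauchy_strip _ _ (- k) (- k0) (fun z => f z * p z)%C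
     ltac:(lra) HmA HvA); [reflexivity|].
  intros y Hy. apply Hd. rewrite Rabs_left; lra.
Qed.

Hypothesis Hannih : forall z0 z1 n, h < Rabs (Im z1) ->
  boundary_integral k (fun z => f z * geom z0 z1 n z)%C = 0.

(** Moving [z0] away from the real axis by [h] gives [z1] outside the closed strip
    of half width [h], with [|z0 - z1| = h], while [Gamma_k0] stays at distance
    [|Im z0| + h - k0 > h] from [z1].  Hence [1 / (z - z0)] is a uniform limit on
    [Gamma_k0] of the functions [geom z0 z1 n], whose integrals against [f] over
    [Gamma_k0] and [Gamma_k] coincide and are 0. *)
Lemma boundary_integral_kernel_outside k0 z0 : b < k0 -> k0 < k -> k0 < Rabs (Im z0) ->
  boundary_integral k0 (fun z => f z * / (z - z0))%C = 0.
Proof.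
  intros Hk0 Hk0k Hz0.
  assert (Hz1 : exists z1, Rabs (Im z1) = Rabs (Im z0) + h /\ Cmod (z0 - z1) = h).
  { assert (Hs : exists e, Rabs (Im z0 + e) = Rabs (Im z0) + h /\ Rabs e = h).
    { destruct (Rle_dec 0 (Im z0)) as [H|H].
      - exists h. rewrite !Rabs_right; lra.
      - exists (- h). rewrite !Rabs_left; lra. }
    destruct Hs as (e & He1 & He2). exists (z0 + Ci * RtoC e)%C. split.
    - rewrite im_plus. replace (Im (Ci * RtoC e)) with e by (simpl; ring). exact He1.
    - replace (z0 - (z0 + Ci * RtoC e))%C with (- (Ci * RtoC e))%C by ring.
      rewrite Cmod_opp, Cmod_mult, Cmod_Ci, Cmod_R. lra. }
  destruct Hz1 as (z1 & Hz1 & Hz01).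
  set (d0 := Rabs (Im z0) - k0). assert (Hd0 : 0 < d0) by (unfold d0; lra).
  set (rho := h / (d0 + h)).
  assert (Hrho0 : 0 <= rho) by (apply Rdiv_le_0_compat; lra).
  assert (Hrho1 : rho < 1) by (apply Rlt_div_l; lra).
  assert (Hker : boundary_dominated (fun x => / d0 * m x) k0 (fun z => f z * / (z - z0))%C).
  { apply boundary_dominated_kernel; [lra|easy|]. unfold d0. apply Rle_abs. }
  assert (Hmd := line_majorant_scal m I (/ d0) (Rlt_le _ _ (Rinv_0_lt_compat _ Hd0)) Hm).
  assert (Hbound : forall n, Cmod (boundary_integral k0 (fun z => f z * / (z - z0))%C)
    <= rho ^ n * (2 * (/ d0 * I))).
  { intros n.
    destruct (Cmod_geom_bounded z0 z1 n (Rabs (Im z0) + h - k)) as (B & HB & HgB); [lra|].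
    assert (Hg : forall z, k0 <= Rabs (Im z) <= k ->
      Cdiff (geom z0 z1 n) z /\ Cmod (geom z0 z1 n z) <= B).
    { intros z Hz. split.
      - apply Cdiff_geom. intros E. rewrite E in Hz. lra.
      - apply HgB. eapply Rle_trans; [|apply Cmod_ge_dAbsIm].
        eapply Rle_trans; [|apply Rle_abs]. lra. }
    assert (Hgeom : boundary_dominated (fun x => B * m x) k0
       (fun z => f z * geom z0 z1 n z)%C).
    { apply boundary_dominated_mult; auto.
      - apply boundary_dominated_f; lra.
      - intros z Hz. apply Hg. rewrite Hz, Rabs_right; lra. }
    assert (HmB := line_majorant_scal m I B HB Hm).
    replace (boundary_integral k0 (fun z => f z * / (z - z0))%C) with
      (boundary_integral k0 (fun z => f z * / (z - z0) - f z * geom z0 z1 n z)%C).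
    2:{ rewrite (boundary_integral_minus _ _ _ _ k0 _ _ Hmd HmB Hker Hgeom).
        rewrite (boundary_integral_shift k0 B (geom z0 z1 n)) by assumption.
        rewrite Hannih by lra. ring. }
    replace (rho ^ n * (2 * (/ d0 * I))) with (2 * (rho ^ n * / d0 * I)) by ring.
    assert (HA : 0 <= rho ^ n * / d0).
    { apply Rmult_le_pos; [now apply pow_le|]. now apply Rlt_le, Rinv_0_lt_compat. }
    assert (HmA := line_majorant_scal m I _ HA Hm).
    assert (Hz : forall z, Rabs (Im z) = Rabs k0 ->
      Cdiff (fun z => / (z - z0) - geom z0 z1 n z)%C z /\
      Cmod (/ (z - z0) - geom z0 z1 n z)%C <= rho ^ n * / d0).
    { intros z Hz. rewrite (Rabs_right k0) in Hz by lra.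
      destruct (kernel_bound z z0 d0 Hd0) as [K1 K2].
      { eapply Rle_trans; [|apply Cmod_ge_dAbsIm].
        eapply Rle_trans; [|apply Rle_abs]. rewrite Hz. apply Rle_refl. }
      split.
      - apply Cdiff_minus; [exact K1|]. apply Hg. lra.
      - eapply Rle_trans; [apply (geom_remainder z0 z1 z rho)|].
        + intros E; rewrite E in Hz; lra.
        + intros E; rewrite E in Hz; lra.
        + exact Hrho0.
        + rewrite Hz01. unfold rho.
          assert (d0 + h <= Cmod (z - z1)).
          { eapply Rle_trans; [|apply Cmod_ge_dAbsIm].
            eapply Rle_trans; [|apply Rle_abs]. unfold d0. lra. }
          apply Rle_trans with (h / (d0 + h) * (d0 + h)).
          * apply Req_le. field. lra.
          * apply Rmult_le_compat_l; [exact Hrho0|lra].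
        + apply Rmult_le_compat_l; [now apply pow_le|exact K2]. }
    assert (Hfin := boundary_dominated_mult m _ k0 f _ HA
      (boundary_dominated_f k0 ltac:(lra)) Hz).
    rewrite <- (boundary_integral_ext _ _ _ _ _ HmA Hfin).
    - now apply Cmod_boundary_integral_le with (1 := HmA).
    - intros z _. ring. }
  apply Cmod_eq_0, Rle_antisym; [|apply Cmod_ge_0].
  apply le_epsilon. intros eps Heps. rewrite Rplus_0_l.
  set (L := 2 * (/ d0 * I)) in Hbound.
  destruct (pow_lt_1_zero rho) with (y := eps / (Rabs L + 1)) as [n Hn].
  { rewrite Rabs_right; lra. }
  { apply Rdiv_lt_0_compat; generalize (Rabs_pos L); lra. }
  specialize (Hn n (Nat.le_refl n)). specialize (Hbound n).
  rewrite Rabs_right in Hn by (apply Rle_ge, pow_le, Hrho0).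
  assert (Hp := pow_le rho n Hrho0).
  apply Rlt_div_r in Hn; [|generalize (Rabs_pos L); lra].
  generalize (Rle_abs L). nra.
Qed.

(** Of the two components of the boundary, the one on the side of [w] contributes
    the residue at [w] between the levels [k0] and [h]; the other contributes
    nothing, by Cauchy's theorem. *)
Lemma boundary_integral_kernel_inside w : b < Rabs (Im w) < h ->
  boundary_integral h (fun z => f z * / (z - w))%C = (2 * PI * Ci * f w)%C.
Proof.
  intros Hw.
  assert (Hk0 : exists k0, b < k0 /\ k0 < k /\ k0 < Rabs (Im w)).
  { exists ((b + Rmin k (Rabs (Im w))) / 2).
    assert (b < Rmin k (Rabs (Im w))) by (apply Rmin_glb_lt; lra).
    generalize (Rmin_l k (Rabs (Im w))) (Rmin_r k (Rabs (Im w))). lra. }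
  destruct Hk0 as (k0 & Hk0 & Hk0k & Hk0w).
  assert (H0 := boundary_integral_kernel_outside k0 w Hk0 Hk0k Hk0w).
  unfold boundary_integral in *.
  set (q := fun z => (f z * / (z - w))%C) in *.
  assert (Hd : 0 < Rabs (Im w)) by lra.
  assert (Hmd := line_majorant_scal m I _ (Rlt_le _ _ (Rinv_0_lt_compat _ Hd)) Hm).
  assert (Hvd := vanishing_scal m _ (Rlt_le _ _ (Rinv_0_lt_compat _ Hd)) Hvan).
  assert (Hq : forall y, k0 <= Rabs y <= h -> Rabs (Im w) <= Rabs (y - Im w) ->
    line_dominated (fun x => / Rabs (Im w) * m x) y q).
  { intros y Hy Hyw. apply line_dominated_kernel; auto. apply Hf; lra. }
  destruct (Rle_dec 0 (Im w)) as [Hs|Hs].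
  - rewrite (Rabs_right (Im w)) in * by lra.
    assert (E := cauchy_formula_strip m I k0 h f w ltac:(lra) Hm Hvan
      ltac:(intros y Hy; apply Hf; rewrite Rabs_right; lra)).
    fold q in E.
    assert (E' := cauchy_strip _ _ (- h) (- k0) q ltac:(lra) Hmd Hvd
      ltac:(intros y Hy; apply Hq; rewrite Rabs_left; lra)).
    rewrite E', <- E. 
    replace (line_integral k0 q - line_integral h q)%C with
      ((line_integral (- k0) q - line_integral h q)
       - (line_integral (- k0) q - line_integral k0 q))%C by ring.
    rewrite H0. ring.
  - rewrite (Rabs_left (Im w)) in * by lra.
    assert (E := cauchy_formula_strip m I (- h) (- k0) f w ltac:(lra) Hm Hvan
      ltac:(intros y Hy; apply Hf; rewrite Rabs_left; lra)).
    fold q in E.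
    assert (E' := cauchy_strip _ _ k0 h q ltac:(lra) Hmd Hvd
      ltac:(intros y Hy; apply Hq; rewrite Rabs_right; lra)).
    rewrite <- E', <- E.
    replace (line_integral (- h) q - line_integral (- k0) q)%C with
      ((line_integral (- h) q - line_integral k0 q)
       - (line_integral (- k0) q - line_integral k0 q))%C by ring.
    rewrite H0. ring.
Qed.
End Continuation.

(** Differentiation under the integral sign.  By the resolvent identity the
    difference of kernels minus its linear part is
    [(w' - w)^2 / ((z - w)^2 (z - w'))], which is at most [|w' - w|^2 / d^3] when
    [d] is half the distance from [w] to the line. *)
Lemma Cdiff_line_cauchy_integral m I y f w : line_majorant m I -> line_dominated m y f ->
  y <> Im w -> Cdiff (fun w => line_integral y (fun z => f z * / (z - w))%C) w.
Proof.
  intros Hm Hf Hy.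
  assert (Hd2 : 0 < Rabs (y - Im w)) by (apply Rabs_pos_lt; lra).
  set (d := Rabs (y - Im w) / 2). assert (Hd : 0 < d) by (unfold d; lra).
  assert (Hi := Rinv_0_lt_compat d Hd).
  assert (Hnear : forall w', Cmod (w' - w) < d -> d <= Rabs (y - Im w')).
  { intros w' Hw'. generalize (Cmod_ge_dIm w' w); intros.
    generalize (Rabs_triang (y - Im w') (Im w' - Im w)).
    replace (y - Im w' + (Im w' - Im w)) with (y - Im w) by ring. unfold d in *. lra. }
  set (ker := fun w' z => (/ (z - w'))%C).
  assert (Hker : forall w', Cmod (w' - w) < d -> forall x,
    Cdiff (ker w') (x, y) /\ Cmod (ker w' (x, y)) <= / d).
  { intros w' Hw' x. apply kernel_bound; auto.
    eapply Rle_trans; [exact (Hnear w' Hw')|]. apply (Cmod_ge_dIm (x, y) w'). }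
  assert (Hww : Cmod (w - w) < d) by (replace (w - w)%C with (RtoC 0) by ring; now rewrite Cmod_0).
  assert (Hmul : forall p q A B, 0 <= A -> 
    (forall x, Cdiff p (x, y) /\ Cmod (p (x, y)) <= A) ->
    (forall x, Cdiff q (x, y) /\ Cmod (q (x, y)) <= B) ->
    forall x, Cdiff (fun z => p z * q z)%C (x, y) /\ Cmod (p (x, y) * q (x, y)) <= A * B).
  { intros p q A B HA Hp Hq x. destruct (Hp x), (Hq x). split.
    - now apply Cdiff_mult.
    - rewrite Cmod_mult. apply Rmult_le_compat; auto using Cmod_ge_0. }
  assert (HK := Hker w Hww).
  assert (HK2 := Hmul _ _ _ _ (Rlt_le _ _ Hi) HK HK).
  assert (Hi2 : 0 <= / d * / d) by (apply Rmult_le_pos; lra).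
  assert (D2 := line_dominated_mult m _ y f _ Hi2 Hf HK2). cbn beta in D2.
  assert (M1 := line_majorant_scal m I _ (Rlt_le _ _ Hi) Hm).
  assert (M2 := line_majorant_scal m I _ Hi2 Hm).
  exists (line_integral y (fun z => f z * (ker w z * ker w z))%C).
  apply is_Cderive_eps. intros eps Heps.
  set (L := / d * / d * / d * I).
  exists (Rmin d (eps / (Rabs L + 1))). split.
  { apply Rmin_pos; [easy|]. apply Rdiv_lt_0_compat; [easy|]. generalize (Rabs_pos L); lra. }
  intros w' Hw'.
  assert (H1 : Cmod (w' - w) < d) by (eapply Rlt_le_trans; [exact Hw'|apply Rmin_l]).
  assert (H2 : Cmod (w' - w) < eps / (Rabs L + 1))
    by (eapply Rlt_le_trans; [exact Hw'|apply Rmin_r]).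
  assert (HK' := Hker w' H1).
  assert (DK := line_dominated_mult m _ y f _ (Rlt_le _ _ Hi) Hf HK).
  assert (DK' := line_dominated_mult m _ y f _ (Rlt_le _ _ Hi) Hf HK').
  assert (HK3 := Hmul _ _ _ _ Hi2 HK2 HK'). cbn beta in HK3.
  assert (Hi3 : 0 <= / d * / d * / d) by (apply Rmult_le_pos; lra).
  assert (D3 := line_dominated_mult m _ y f _ Hi3 Hf HK3). cbn beta in D3.
  assert (M3 := line_majorant_scal m I _ Hi3 Hm).
  set (u := (w' - w)%C) in *.
  assert (E : (line_integral y (fun z => f z * ker w' z) - line_integral y (fun z => f z * ker w z)
     - u * line_integral y (fun z => f z * (ker w z * ker w z)))%C
     = (u * (u * line_integral y (fun z => f z * (ker w z * ker w z * ker w' z))))%C).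
  { rewrite <- (line_integral_Cmult _ _ y u _ M2 D2).
    rewrite <- (line_integral_Cmult _ _ y u _ M3 D3).
    assert (D3u := line_dominated_Cmult _ y u _ D3).
    assert (M3u := line_majorant_scal _ _ _ (Cmod_ge_0 u) M3).
    rewrite <- (line_integral_Cmult _ _ y u _ M3u D3u).
    rewrite <- (line_integral_minus _ _ _ _ y _ _ M1 M1 DK' DK).
    assert (D2u := line_dominated_Cmult _ y u _ D2).
    assert (M2u := line_majorant_scal _ _ _ (Cmod_ge_0 u) M2).
    assert (D3uu := line_dominated_Cmult _ y u _ D3u).
    assert (M3uu := line_majorant_scal _ _ _ (Cmod_ge_0 u) M3u).
    assert (Mdd := line_majorant_scal m I (2 * / d) ltac:(lra) Hm).
    assert (Ddd : line_dominated (fun x => 2 * / d * m x) y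
      (fun z => f z * ker w' z - f z * ker w z)%C).
    { intros x. destruct (DK x), (DK' x). split; [now apply Cdiff_minus|].
      eapply Rle_trans; [apply Cmod_minus_triangle|]. lra. }
    rewrite <- (line_integral_minus _ _ _ _ y _ _ Mdd M2u Ddd D2u).
    symmetry. apply (line_integral_ext _ _ y _ _ M3uu D3uu).
    intros x.
    assert (N : ((x, y) - w)%C <> 0).
    { apply Cminus_0_neq. intros E. apply Hy. now rewrite <- E. }
    assert (N' : ((x, y) - w')%C <> 0).
    { apply Cminus_0_neq. intros E. specialize (Hnear w' H1). rewrite <- E in Hnear.
      simpl in Hnear. rewrite Rminus_diag, Rabs_R0 in Hnear. lra. }
    unfold u, ker. field. split; assumption. }
  fold (ker w) (ker w'). unfold ker at 1 2 in E. rewrite E.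
  assert (B3 := Cmod_line_integral_le _ _ _ _ M3 D3). fold L in B3.
  rewrite !Cmod_mult, Rmult_comm.
  apply Rmult_le_compat_r; [apply Cmod_ge_0|].
  assert (HL := Rabs_pos L).
  apply Rlt_div_r in H2; [|lra].
  generalize (Rle_abs L) (Cmod_ge_0 u). nra.
Qed.

Lemma Cdiff_cauchy_integral m I k f w : line_majorant m I -> boundary_dominated m k f ->
  Rabs (Im w) < k -> Cdiff (fun w => boundary_integral k (fun z => f z * / (z - w)))%C w.
Proof.
  intros Hm [F1 F2] Hw. apply Rabs_def2 in Hw.
  apply (Cdiff_minus (fun w => line_integral (- k) (fun z => f z * / (z - w)))%C
    (fun w => line_integral k (fun z => f z * / (z - w)))%C);
  apply Cdiff_line_cauchy_integral with m I; auto; lra.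
Qed.

(** * The analytic extension *)

Lemma Cdiff_ext_ball (f g : C -> C) z d : 0 < d ->
  (forall w, Cmod (w - z) < d -> f w = g w) -> Cdiff f z -> Cdiff g z.
Proof.
  intros Hd H. apply (@ex_derive_ext_loc C_AbsRing C_NormedModule f g z).
  exists (mkposreal d Hd). exact H.
Qed.

(** The difference [v - u] is eventually negative, and on a bounded interval it is
    at most the value of [v] at the end, as [u >= 0] and [v] is monotone. *)
Lemma exp_weight_bounded (u v : R -> R) :
  (forall t, 0 <= t -> 0 <= u t) -> (forall s t, 0 <= s -> s <= t -> v s <= v t) ->
  is_lim (fun t => u t - v t) p_infty p_infty ->
  exists D, forall t, 0 <= t -> exp (v t - u t) <= D.
Proof.
  intros Hu Hv H.
  assert (H' : Rbar_locally p_infty (fun t => 0 < u t - v t)).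
  { apply (H (fun y => 0 < y)). now exists 0. }
  destruct H' as [B HB].
  exists (exp (Rmax 0 (v (Rmax 0 B)))). intros t Ht.
  apply Rnot_lt_le. intros Hlt. apply exp_lt_inv in Hlt. revert Hlt. apply Rle_not_lt.
  destruct (Rlt_dec B t) as [H1|H1].
  - specialize (HB t H1). generalize (Rmax_l 0 (v (Rmax 0 B))). lra.
  - assert (v t <= v (Rmax 0 B)) by (apply Hv; [easy|]; generalize (Rmax_r 0 B); lra).
    specialize (Hu t Ht). generalize (Rmax_r 0 (v (Rmax 0 B))). lra.
Qed.

Lemma strip_Rabs r z : strip r z <-> Rabs (Im z) < r.
Proof.
  unfold strip. split; intros H.
  - apply Rabs_def1; lra.
  - destruct (Rabs_def2 _ _ H); lra.
Qed.

Lemma strip_diff_Rabs b r z : strip_diff b r z <-> b < Rabs (Im z) < r.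
Proof.
  unfold strip_diff. rewrite strip_Rabs, <- Rabs_le_between.
  split; intros H; split; try apply H.
  - now apply Rnot_le_lt.
  - now apply Rlt_not_le.
Qed.

(** The reason for the lower bound on [P]: dividing by [P] turns growth [exp omega]
    into an integrable majorant, and bounded functions into test functions. *)
Section Division.
Variables (r C1 : R) (sigma : R -> R) (P : C -> C).
Hypothesis HC1 : 0 < C1.
Hypothesis HPd : analytic_on (strip r) P.
Hypothesis HPlow : forall z, strip r z -> C1 * exp (sigma (Rabs (Re z))) <= Cmod (P z).

Lemma P_neq_0 z : strip r z -> P z <> 0.
Proof.
  intros Hz. apply Cmod_gt_0. eapply Rlt_le_trans; [|now apply HPlow].
  apply Rmult_lt_0_compat; [easy|apply exp_pos].
Qed.

Lemma Cdiff_inv_P z : strip r z -> Cdiff (fun z => / P z)%C z.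
Proof. intros Hz. apply Cdiff_inv; [now apply HPd|now apply P_neq_0]. Qed.

Lemma line_dominated_div b M omega F : 0 <= M ->
  analytic_on (strip_diff b r) F ->
  (forall z, strip_diff b r z -> Cmod (F z) <= M * exp (omega (Rabs (Re z)))) ->
  forall y, b < Rabs y < r ->
  line_dominated (fun x => M / C1 * exp (omega (Rabs x) - sigma (Rabs x))) y
    (fun z => F z * / P z)%C.
Proof.
  intros HM HFd HFM y Hy x.
  assert (Hz : strip_diff b r (x, y)) by now apply strip_diff_Rabs.
  assert (Hz' := proj1 Hz). split.
  - apply Cdiff_mult; [now apply HFd|now apply Cdiff_inv_P].
  - rewrite Cmod_mult, Cmod_inv by now apply P_neq_0.
    specialize (HFM _ Hz). assert (HP1 := HPlow _ Hz'). simpl in HFM, HP1.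
    unfold Rminus. rewrite exp_plus, exp_Ropp.
    assert (He := exp_pos (sigma (Rabs x))).
    replace (M / C1 * (exp (omega (Rabs x)) * / exp (sigma (Rabs x))))
      with (M * exp (omega (Rabs x)) * / (C1 * exp (sigma (Rabs x)))) by (field; lra).
    apply Rmult_le_compat; auto using Cmod_ge_0.
    + apply Rlt_le, Rinv_0_lt_compat, Cmod_gt_0. now apply P_neq_0.
    + apply Rinv_le_contravar; [now apply Rmult_lt_0_compat|easy].
Qed.

Lemma space_A_geom_div h z0 z1 n : h < r -> h < Rabs (Im z1) ->
  space_A sigma h (fun z => geom z0 z1 n z * / P z)%C.
Proof.
  intros Hhr Hz1.
  destruct (Cmod_geom_bounded z0 z1 n (Rabs (Im z1) - h)) as (B & HB & HgB); [lra|].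
  split.
  - intros z Hz. rewrite strip_Rabs in Hz. apply Cdiff_mult.
    + apply Cdiff_geom. intros E. rewrite E in Hz. lra.
    + apply Cdiff_inv_P, strip_Rabs. lra.
  - exists (B / C1). intros z Hz. rewrite strip_Rabs in Hz.
    assert (Hr : strip r z) by (apply strip_Rabs; lra).
    assert (HP1 := HPlow z Hr).
    assert (HPz : 0 < Cmod (P z)) by now apply Cmod_gt_0, P_neq_0.
    rewrite Cmod_mult, Cmod_inv by now apply P_neq_0.
    rewrite Rmult_assoc. apply Rmult_le_compat; auto using Cmod_ge_0.
    + apply Rmult_le_pos; [now apply Rlt_le, Rinv_0_lt_compat|apply Rlt_le, exp_pos].
    + apply HgB. eapply Rle_trans; [|apply Cmod_ge_dAbsIm].
      eapply Rle_trans; [|apply Rle_abs]. lra.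
    + rewrite Rmult_comm. apply Rle_div_l; [easy|].
      apply Rle_trans with (/ C1 * (C1 * exp (sigma (Rabs (Re z))))).
      * apply Req_le. field. lra.
      * apply Rmult_le_compat_l; [now apply Rlt_le, Rinv_0_lt_compat|easy].
Qed.
End Division.

Theorem proposition5p3
  (b h r : R) (hb : 0 < b) (hbh : b < h) (hhr : h < r)
  (omega sigma kappa : R -> R)
  (homega : weight_function omega)
  (hsigma : weight_function sigma)
  (hkappa : weight_function kappa)
  (hlim1 : is_lim (fun t => sigma t - omega t) p_infty p_infty)
  (hlim2 : is_lim (fun t => kappa t - sigma t) p_infty p_infty)
  (hint1 : int_0_infty_finite (fun t => exp (omega t - sigma t)))
  (hint2 : int_0_infty_finite (fun t => exp (sigma t - kappa t)))
  (hP : exists P : C -> C, analytic_on (strip r) P /\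
     exists C1 C2 : R, 0 < C1 /\ 0 < C2 /\
       forall z : C, strip r z ->
         C1 * exp (sigma (Rabs (Re z))) <= Cmod (P z) /\
         Cmod (P z) <= C2 * exp (kappa (Rabs (Re z))))
  (k : R) (hbk : b < k) (hkh : k < h)
  (F : C -> C) (hF : space_O omega b r F)
  (hbv : forall phi : C -> C, space_A sigma h phi -> bv k F phi = RtoC 0) :
  exists G : C -> C, space_P kappa r G /\
    forall z : C, strip_diff b r z -> G z = F z.
Proof.
  destruct hP as (P & HPd & C1 & C2 & HC1 & HC2 & HP).
  destruct hF as (HFd & M0 & HFM0).
  (* the absolute value makes the constant nonnegative without exhibiting a point *)
  assert (HM : exists M, 0 <= M /\ forall z, strip_diff b r z ->
    Cmod (F z) <= M * exp (omega (Rabs (Re z)))).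
  { exists (Rabs M0). split; [apply Rabs_pos|]. intros z Hz. specialize (HFM0 z Hz).
    rewrite exp_Ropp in HFM0. apply Rle_div_l in HFM0; [|apply exp_pos].
    eapply Rle_trans; [exact HFM0|].
    apply Rmult_le_compat_r; [apply Rlt_le, exp_pos|apply Rle_abs]. }
  destruct HM as (M & HM & HFM).
  assert (HPlow : forall z, strip r z -> C1 * exp (sigma (Rabs (Re z))) <= Cmod (P z)).
  { intros z Hz. now apply HP. }
  assert (HP0 := P_neq_0 r C1 sigma P HC1 HPlow).
  set (f := fun z => (F z * / P z)%C).
  set (m0 := fun t => exp (omega t - sigma t)).
  destruct (line_majorant_even m0 (fun t => Rlt_le _ _ (exp_pos _)) hint1) as [I0 HI0].
  assert (HA : 0 <= M / C1) by (apply Rdiv_le_0_compat; lra).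
  set (m := fun x => M / C1 * m0 (Rabs x)).
  set (I := M / C1 * I0).
  assert (Hm : line_majorant m I) by exact (line_majorant_scal _ _ _ HA HI0).
  assert (Hvan : vanishing m) by exact (vanishing_scal _ _ HA (vanishing_even sigma omega hlim1)).
  assert (Hf : forall y, b < Rabs y < r -> line_dominated m y f)
    by exact (line_dominated_div r C1 sigma P HC1 HPd HPlow b M omega F HM HFd HFM).
  assert (Htest : forall z0 z1 n, h < Rabs (Im z1) ->
    boundary_integral k (fun z => f z * geom z0 z1 n z)%C = 0).
  { intros z0 z1 n Hz1.
    assert (Hphi := space_A_geom_div r C1 sigma P HC1 HPd HPlow h z0 z1 n hhr Hz1).
    specialize (hbv _ Hphi). unfold bv in hbv.
    destruct (Cmod_geom_bounded z0 z1 n (Rabs (Im z1) - k)) as (B & HB & HgB); [lra|].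
    assert (Hd : boundary_dominated (fun x => B * m x) k (fun z => f z * geom z0 z1 n z)%C).
    { apply boundary_dominated_mult; auto.
      - apply (boundary_dominated_f b r f m hb Hf); lra.
      - intros z Hz. rewrite (Rabs_right k) in Hz by lra. split.
        + apply Cdiff_geom. intros E. rewrite E in Hz. lra.
        + apply HgB. eapply Rle_trans; [|apply Cmod_ge_dAbsIm].
          eapply Rle_trans; [|apply Rle_abs]. lra. }
    rewrite (boundary_integral_ext _ _ k _ (fun z => F z * (geom z0 z1 n z * / P z))%C
      (line_majorant_scal _ _ _ HB Hm) Hd) by (intros z _; unfold f; ring).
    rewrite <- (Copp_0), <- hbv. ring. }
  set (K := fun w => boundary_integral h (fun z => f z * / (z - w))%C).
  assert (Hpi : (2 * PI * Ci)%C <> 0).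
  { repeat apply Cmult_neq_0; [intros E; apply RtoC_inj in E; lra| |apply Ci_nz].
    intros E. apply RtoC_inj in E. generalize PI_RGT_0; lra. }
  set (cst := (/ (2 * PI * Ci))%C).
  assert (HK : forall w, b < Rabs (Im w) < h -> (P w * (cst * K w))%C = F w).
  { intros w Hw. unfold K, cst.
    rewrite (boundary_integral_kernel_inside b k h r f m I) by (auto; lra).
    unfold f. fold cst.
    replace (P w * (cst * (2 * PI * Ci * (F w * / P w))))%C
      with ((P w * / P w) * (cst * (2 * PI * Ci)) * F w)%C by ring.
    unfold cst. rewrite Cinv_r, Cinv_l by (auto; apply HP0, strip_Rabs; lra). ring. }
  assert (Hfh : boundary_dominated m h f) by (apply (boundary_dominated_f b r f m hb Hf); lra).
  (* Both expressions are analytic, on overlapping open sets, and they agree on the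
     overlap by [HK]. *)
  set (G := fun z => if Rlt_dec (Rabs (Im z)) h then (P z * (cst * K z))%C else F z).
  assert (HG1 : forall z, Rabs (Im z) < h -> G z = (P z * (cst * K z))%C).
  { intros z Hz. unfold G. destruct (Rlt_dec (Rabs (Im z)) h); [easy|lra]. }
  assert (HG2 : forall z, strip_diff b r z -> G z = F z).
  { intros z Hz. unfold G. destruct (Rlt_dec (Rabs (Im z)) h) as [H|H]; [|easy].
    apply HK. split; [now apply (strip_diff_Rabs b r z)|easy]. }
  exists G. split; [|exact HG2].
  assert (Hopen : forall z w, Rabs (Rabs (Im w) - Rabs (Im z)) <= Cmod (w - z)).
  { intros z w. rewrite Cmod_minus_sym. apply Cmod_ge_dAbsIm. }
  split.
  - intros z Hz. assert (Hz' : Rabs (Im z) < r) by now apply strip_Rabs.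
    destruct (Rlt_dec (Rabs (Im z)) h) as [H|H].
    + apply (Cdiff_ext_ball (fun z => P z * (cst * K z))%C G z (h - Rabs (Im z))); [lra| |].
      * intros w Hw. symmetry. apply HG1.
        generalize (Hopen z w) (Rle_abs (Rabs (Im w) - Rabs (Im z))). lra.
      * apply Cdiff_mult; [now apply HPd|].
        apply (Cdiff_mult (fun _ => cst) K); [apply Cdiff_const|].
        exact (Cdiff_cauchy_integral m I h f z Hm Hfh H).
    + apply (Cdiff_ext_ball F G z (Rmin (Rabs (Im z) - b) (r - Rabs (Im z)))).
      * apply Rmin_pos; lra.
      * intros w Hw. symmetry. apply HG2, strip_diff_Rabs.
        generalize (Rmin_l (Rabs (Im z) - b) (r - Rabs (Im z)))
          (Rmin_r (Rabs (Im z) - b) (r - Rabs (Im z)))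
          (Hopen z w) (Rle_abs (Rabs (Im w) - Rabs (Im z)))
          (Rle_abs (- (Rabs (Im w) - Rabs (Im z)))).
        rewrite Rabs_Ropp. lra.
      * apply HFd, strip_diff_Rabs. lra.
  - destruct (exp_weight_bounded sigma omega) as [D HD]; auto.
    { apply hsigma. } { apply homega. }
    (* [B1] serves outside the closed strip of half width [b], where [G = F] and
       [exp omega <= D exp sigma <= (D C2 / C1) exp kappa]; [B2] serves inside, where
       the lines of integration are at distance at least [h - b]. *)
    set (B1 := M * D * C2 / C1).
    set (B2 := C2 * (Cmod cst * (2 * (/ (h - b) * I)))).
    exists (Rmax B1 B2). intros z Hz.
    assert (Hz' : Rabs (Im z) < r) by now apply strip_Rabs.
    assert (Ht := Rabs_pos (Re z)).
    destruct (HP z Hz) as [HPl HPu].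
    rewrite exp_Ropp.
    assert (Hek := exp_pos (kappa (Rabs (Re z)))).
    assert (Hes := exp_pos (sigma (Rabs (Re z)))).
    apply (Rle_div_l _ _ _ Hek).
    destruct (Rlt_dec b (Rabs (Im z))) as [H|H].
    + assert (Hs : strip_diff b r z) by (apply strip_diff_Rabs; lra).
      rewrite HG2 by easy.
      apply Rle_trans with (B1 * exp (kappa (Rabs (Re z)))).
      2:{ apply Rmult_le_compat_r; [lra|apply Rmax_l]. }
      eapply Rle_trans; [now apply HFM|].
      specialize (HD _ Ht). unfold Rminus in HD. rewrite exp_plus, exp_Ropp in HD.
      apply (Rle_div_l _ _ _ Hes) in HD.
      assert (HD0 : 0 <= D).
      { generalize (exp_pos (omega (Rabs (Re z)))); intros. nra. }
      assert (Hsk : exp (sigma (Rabs (Re z))) <= C2 / C1 * exp (kappa (Rabs (Re z)))).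
      { apply Rmult_le_reg_l with C1; [easy|].
        replace (C1 * (C2 / C1 * exp (kappa (Rabs (Re z)))))
          with (C2 * exp (kappa (Rabs (Re z)))) by (field; lra). lra. }
      replace (B1 * exp (kappa (Rabs (Re z)))) with
        (M * (D * (C2 / C1 * exp (kappa (Rabs (Re z)))))) by (unfold B1; field; lra).
      apply Rmult_le_compat_l; [easy|]. eapply Rle_trans; [exact HD|].
      now apply Rmult_le_compat_l.
    + apply Rle_trans with (B2 * exp (kappa (Rabs (Re z)))).
      2:{ apply Rmult_le_compat_r; [lra|apply Rmax_r]. }
      rewrite HG1 by lra. rewrite !Cmod_mult.
      replace (B2 * exp (kappa (Rabs (Re z)))) with
        ((C2 * exp (kappa (Rabs (Re z)))) * (Cmod cst * (2 * (/ (h - b) * I))))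
        by (unfold B2; ring).
      assert (HKz : Cmod (K z) <= 2 * (/ (h - b) * I)).
      { assert (Hd : 0 < h - b) by lra.
        apply (Cmod_boundary_integral_le (fun x => / (h - b) * m x) (/ (h - b) * I) h
          (fun z' => f z' * / (z' - z))%C).
        - apply line_majorant_scal; [now apply Rlt_le, Rinv_0_lt_compat|easy].
        - apply (boundary_dominated_kernel b r f m hb Hf); [lra|lra|].
          rewrite Rabs_left1; lra. }
      apply Rmult_le_compat; auto using Cmod_ge_0.
      { apply Rmult_le_pos; apply Cmod_ge_0. }
      apply Rmult_le_compat_l; [apply Cmod_ge_0|easy].
Qed.
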